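(* There are absolute constants $\epsilon,\gamma>0$ and a polynomially bounded function $m=m(n)=\mathrm{poly}(n)$ such that there is no $(1-\epsilon)$-approximately truthful-in-expectation mechanism for combinatorial auctions with $n$ players, $m$ items and monotone submodular valuation functions in the value oracle model which uses a number of value queries bounded by a polynomial in $n$ and which, for all sufficiently large $n$, achieves a better than $1/n^{\gamma}$-approximation in expectation in terms of social welfare.
   Context: Combinatorial auctions: there is a set $M$ of $m$ items and $n$ players. Player $i$ has a valuation $v_i:2^M\to\mathbb{R}_+$ that is normalized ($v_i(\emptyset)=0$), monotone ($v_i(A)\le v_i(B)$ for $A\subseteq B$) and submodular ($v_i(S\cup\{j\})-v_i(S)$ is non-increasing in $S$, for each item $j \notin S$). A feasible solution is an allocation $(S_1,\dots,S_n)$ of pairwise disjoint subsets of $M$; player $i$'s value for it is $v_i(S_i)$; the social welfare is $\sum_i v_i(S_i)$. A (randomized, direct-revelation) mechanism consists of an allocation rule $\mathcal{A}$, mapping reported valuations $v=(v_1,\dots,v_n)$ to a random allocation $\mathcal{A}(v)$, and a payment rule $p$, mapping reported valuations to random payments $p_i(v)$. Mechanisms are assumed individually rational in expectation ($\mathbf{E}[v_i(\mathcal{A}(v))-p_i(v)]\ge 0$) and to have non-negative expected payments ($\mathbf{E}[p_i(v)]\ge 0$), for all $i$ and $v$. The mechanism is $(1-\epsilon)$-approximately truthful-in-expectation if for every player $i$, every $v_i$, $v_i'$ and every $v_{-i}$ (valuations of the other players), $$\mathbf{E}[v_i(\mathcal{A}(v))-p_i(v)]\ \ge\ (1-\epsilon)\,\mathbf{E}[v_i(\mathcal{A}(v_i',v_{-i}))-p_i(v_i',v_{-i})],$$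 where $v=(v_i,v_{-i})$ and the expectation is over the coin flips of the mechanism. Value oracle model: the mechanism can access each $v_i$ only through queries $S\subseteq M$ answered by $v_i(S)$. The mechanism achieves a $c$-approximation in expectation if for every input $v$ the expected social welfare of $\mathcal{A}(v)$ is at least $c$ times the maximum social welfare; ''better than $1/n^\gamma$'' means $c=c(n)>n^{-\gamma}$. *)

(* Defs.v *)
From mathcomp Require Import all_boot all_order all_algebra.
From mathcomp Require Import all_classical all_reals all_analysis.
Import Order.TTheory GRing.Theory Num.Theory.
Import numFieldNormedType.Exports.

Set Implicit Arguments.
Unset Strict Implicit.
Unset Printing Implicit Defensive.

Local Open Scope classical_set_scope.
Local Open Scope ring_scope.

Definition poly_bounded (f : nat -> nat) : Prop :=
  exists p : {poly nat}, forall n, (f n <= p.[n])%N.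

Record valuation (R : realType) (m : nat) := Valuation {
  value :> {set 'I_m} -> R;
  value_ge0 : forall S, 0 <= value S;
  value_set0 : value finset.set0 = 0;
  value_monotone : forall A B : {set 'I_m}, A \subset B -> value A <= value B;
  value_submodular : forall (A B : {set 'I_m}) (j : 'I_m),
    A \subset B -> j \notin B ->
    value (j |: B)%SET - value B <= value (j |: A)%SET - value A
}.

Definition profile (R : realType) (n m : nat) := 'I_n -> valuation R m.

Definition allocation (n m : nat) := {ffun 'I_n -> {set 'I_m}}.

Definition feasible n m (S : allocation n m) : bool :=
  [forall i, forall j, (i != j) ==> [disjoint S i & S j]].

Definition welfare (R : realType) n m (v : profile R n m)
    (S : allocation n m) : R :=
  \sum_(i < n) v i (S i).

(* Welfare is nonnegative and the empty allocation is feasible, so the default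
   value 0 does not affect the maximum. *)
Definition max_welfare (R : realType) n m (v : profile R n m) : R :=
  \big[Num.max/0]_(S : allocation n m | feasible S) welfare v S.

(* A deterministic adaptive value-query algorithm: [Query i Q k] asks for
   v_i(Q) and continues with [k (v_i(Q))]; [Output alloc pay] stops. *)
Inductive query_tree (R : realType) (n m : nat) : Type :=
| Output of allocation n m & ('I_n -> R)
| Query of 'I_n & {set 'I_m} & (R -> query_tree R n m).

Fixpoint run (R : realType) n m (t : query_tree R n m) (v : profile R n m)
    : allocation n m * ('I_n -> R) :=
  match t with
  | Output alloc pay => (alloc, pay)
  | Query i Q k => run (k (v i Q)) v
  end.

(* Since trees branch over R, their depth may be infinite although every run
   is finite; hence queries are counted along the run on a given input. *)
Fixpoint num_queries (R : realType) n m (t : query_tree R n m)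
    (v : profile R n m) : nat :=
  match t with
  | Output _ _ => 0
  | Query i Q k => (num_queries (k (v i Q)) v).+1
  end.

(* A randomized mechanism is a random query algorithm, drawn according to an
   arbitrary probability space of coin flips. The last two fields make all the
   expectations below well defined and finite. *)
Record mechanism (R : realType) (n m : nat) := Mechanism {
  coin_display : measure_display;
  coins : measurableType coin_display;
  coin_law : probability coins R;
  algorithm : coins -> query_tree R n m;
  alloc_rule (v : profile R n m) (w : coins) : allocation n m :=
    (run (algorithm w) v).1;
  payment_rule (v : profile R n m) (i : 'I_n) (w : coins) : R :=
    (run (algorithm w) v).2 i;
  alloc_rule_feasible : forall v w, feasible (alloc_rule v w);
  alloc_rule_measurable : forall v S, measurable [set w | alloc_rule v w = S];
  payment_rule_integrable : forall v i,
    coin_law.-integrable setT (EFin \o payment_rule v i)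
}.

Arguments algorithm {R n m} _ _.
Arguments alloc_rule {R n m} _ _ _.
Arguments payment_rule {R n m} _ _ _ _.

Section MechanismProperties.
Context (R : realType) (n m : nat) (M : mechanism R n m).

(* Expected utility of a player [i] with true valuation [u] when the reported
   profile is [v]. *)
Definition expected_utility (u : valuation R m) (v : profile R n m) (i : 'I_n)
    : \bar R :=
  'E_(coin_law M)[fun w => u (alloc_rule M v w i) - payment_rule M v i w].

Definition individually_rational : Prop :=
  forall (v : profile R n m) (i : 'I_n),
    (0 <= expected_utility (v i) v i)%E.

Definition nonneg_payments : Prop :=
  forall (v : profile R n m) (i : 'I_n),
    (0 <= 'E_(coin_law M)[payment_rule M v i])%E.

Definition approx_truthful (eps : R) : Prop :=
  forall (v : profile R n m) (i : 'I_n) (vi' : valuation R m),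
    (expected_utility (v i) v i >=
     (1 - eps)%:E * expected_utility (v i) [eta v with i |-> vi'] i)%E.

Definition queries_at_most (q : nat) : Prop :=
  forall (w : coins M) (v : profile R n m),
    (num_queries (algorithm M w) v <= q)%N.

Definition achieves_approximation (c : R) : Prop :=
  forall v : profile R n m,
    ('E_(coin_law M)[fun w => welfare v (alloc_rule M v w)] >=
     (c * max_welfare v)%:E)%E.

End MechanismProperties.

(* Main.v *)
(** A valuation "shade A" is phi(|S :&: A|) for a fixed concave phi that behaves
like a power function on the relevant scales.  Let B be a random half of A.  There
is a submodular valuation f_B that coincides with phi(|S :&: A|) on every S
splitting evenly between A :&: B and A :\: B, and that is at least
kappa phi(|S :&: A :&: B|), for a constant kappa > 1, up to a small error.  An algorithm
making polynomially many value queries cannot tell f_B from shade A, so on reporting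
f_B a player gets a bundle on which the two valuations agree.  Truthfulness
against the deviations f_B -> kappa shade (A :&: B) and shade A -> f_B then shows that
the utility of a player with valuation shade A is at least (1 - eps)^2 times the
utility he would have with valuation kappa shade (A :&: B).  Iterating log n times from
the set M of all items gains a factor kappa^(log n) = n^const for a random subset T of M of
density 1/n: a player with valuation shade M must receive much more value than he would
get for kappa^(log n) shade T.

Now let each player independently have, with equal probability, the valuation
shade M or (half of) kappa^(log n) shade T for his own random T.  The optimum is at
least about n kappa^(log n) phi(|M| / n), and a good approximation must on average give
players of the second kind value n^(-gamma) kappa^(log n) phi(|M| / n); by the above,
players of the first kind get on average more than phi(|M| / n) by a power of n,
contradicting the concavity of phi since the bundles are disjoint.  Individual
rationality and nonnegative payments convert utilities into values. *)

Require Import Defs.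
From mathcomp Require Import all_boot all_order all_algebra.
From mathcomp Require Import all_classical all_reals all_analysis.
From mathcomp Require Import zify ring lra.
Import Order.TTheory GRing.Theory Num.Theory.
Import numFieldNormedType.Exports.

Set Implicit Arguments.
Unset Strict Implicit.
Unset Printing Implicit Defensive.

Local Open Scope ring_scope.

(** * Submodular functions of two cardinalities *)

(* [K - defect K b x y / (4 K)] is [K - (K - x')^+ (K - y')^+ / K], where [x'] and [y'] are
   [x] and [y] moved towards each other by [b] each, or both to their mean when
   they differ by at most [2 b]; truncated subtraction takes the positive parts. *)
Definition defect (K b x y : nat) : nat :=
  if (y + 2 * b <= x)%N then ((2 * (K + b - x)) * (2 * (K - b - y)))%N
  else if (x + 2 * b <= y)%N then ((2 * (K + b - y)) * (2 * (K - b - x)))%N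
  else ((2 * K - (x + y)) * (2 * K - (x + y)))%N.

Lemma defect_sym K b x y : (0 < b)%N -> defect K b x y = defect K b y x.
Proof.
rewrite /defect => b0; case: (leqP (y + 2 * b) x) => h1; case: (leqP (x + 2 * b) y) => h2 //.
  lia.
by rewrite (addnC x).
Qed.

Lemma defect_balanced K b x y : (x <= y + 2 * b)%N -> (y <= x + 2 * b)%N ->
  defect K b x y = ((2 * K - (x + y)) * (2 * K - (x + y)))%N.
Proof.
rewrite /defect => h1 h2; case: leqP => h3; first by congr muln; lia.
by case: leqP => h4 //; congr muln; lia.
Qed.

Lemma defect_right K b x y : (y + 2 * b <= x)%N ->
  defect K b x y = ((2 * (K + b - x)) * (2 * (K - b - y)))%N.
Proof. by rewrite /defect => ->. Qed.

Lemma mul_le_sq (u v t : nat) : (u + v <= 2 * t)%N -> (u * v <= t * t)%N.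
Proof.
move=> h; rewrite -(@leq_pmul2l 4) //.
have [agm _] := nat_AGM2 u v.
have : ((u + v) ^ 2 <= (2 * t) ^ 2)%N by rewrite leq_exp2r.
by rewrite expnMn -(mulnn t); apply: leq_trans.
Qed.

(** AM-GM: outside the balanced zone the two factors add up to twice the balanced one. Truncated
    subtraction makes a vanishing factor a separate case. *)
Lemma defect_le K b x y : (0 < b)%N ->
  (defect K b x y <= (2 * K - (x + y)) * (2 * K - (x + y)))%N.
Proof.
move=> b0; wlog xy : x y / (y <= x)%N.
  move=> h; case: (leqP y x) => xy; first exact: h.
  by rewrite defect_sym // addnC h // ltnW.
case: (leqP (y + 2 * b) x) => h; last by rewrite defect_balanced //; lia.
rewrite defect_right //.
case: (leqP (K + b) x) => h1.
  have ->: (K + b - x = 0)%N by lia.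
  by rewrite muln0 mul0n.
case: (leqP (K - b) y) => h2.
  have ->: (K - b - y = 0)%N by lia.
  by rewrite !muln0.
by apply: mul_le_sq; lia.
Qed.

Lemma defect_decr K b x y : (0 < b)%N -> (defect K b x.+1 y <= defect K b x y)%N.
Proof.
move=> b0.
case: (leqP (y + 2 * b) x) => h1.
  by rewrite !defect_right ?leq_mul //; lia.
case: (leqP (x + 2 * b).+1 y) => h2.
  rewrite !(@defect_sym _ _ _ y) // !defect_right ?leq_mul //; lia.
by rewrite !defect_balanced ?leq_mul //; lia.
Qed.

Lemma defect_convex K b x y : (0 < b)%N ->
  (2 * defect K b x.+1 y <= defect K b x y + defect K b x.+2 y)%N.
Proof.
move=> b0.
case: (leqP (y + 2 * b) x) => h1.
  rewrite !defect_right; try lia.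
  rewrite mulnA -mulnDl leq_mul2r; apply/orP; right; lia.
case: (leqP (x + 2 * b).+2 y) => h2.
  rewrite !(@defect_sym _ _ _ y) // !defect_right; try lia.
(* The three points straddle two regimes only at [x.+1 = y + 2 * b] and at [y = x.+1 + 2 * b];
   otherwise the defect is along them a truncated linear function or a truncated square. *)
case: (eqVneq x.+1 (y + 2 * b)%N) => h3.
  rewrite (@defect_balanced _ _ x); try lia.
  rewrite !defect_right; try lia.
  case: (leqP (K - b) y) => h4; first by have ->: (K - b - y = 0)%N; [lia | rewrite !muln0].
  have [u ->] : exists u, K = (b + y + u.+1)%N by exists (K - b - y).-1; lia.
  have ->: x = (y + 2 * b).-1 by lia.
  have ->: (b + y + u.+1 + b - (y + 2 * b).-1.+1 = u.+1)%N by lia.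
  have ->: (b + y + u.+1 - b - y = u.+1)%N by lia.
  have ->: (b + y + u.+1 + b - (y + 2 * b).-1.+2 = u)%N by lia.
  have ->: (2 * (b + y + u.+1) - ((y + 2 * b).-1 + y) = 2 * u.+1 + 1)%N by lia.
  nia.
case: (eqVneq y (x.+1 + 2 * b)%N) => h4.
  rewrite (@defect_balanced _ _ x.+2); try lia.
  rewrite !(@defect_sym _ _ _ y) // !defect_right; try lia.
rewrite !defect_balanced; try lia.
have [u hu] : exists u, u = (2 * K - (x.+1 + y))%N by exists (2 * K - (x.+1 + y))%N.
rewrite -hu.
case: u hu => [|u] hu //.
have ->: (2 * K - (x + y) = u.+2)%N by lia.
have ->: (2 * K - (x.+2 + y) = u)%N by lia.
nia.
Qed.

(** Far from the diagonal the defect is a decreasing function of [x] times a decreasing function of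
    [y]. Near it, the corners [(x, y)] and [(x.+1, y.+1)] are balanced, [defect_le] bounds the other
    two, and the convexity of a truncated square remains. *)
Lemma defect_cross K b x y : (0 < b)%N ->
  (defect K b x.+1 y + defect K b x y.+1 <= defect K b x y + defect K b x.+1 y.+1)%N.
Proof.
move=> b0.
wlog xy : x y / (y <= x)%N.
  move=> h; case: (leqP y x) => xy; first exact: h.
  rewrite (@defect_sym _ _ x.+1 y) // (@defect_sym _ _ x) //.
  rewrite (@defect_sym _ _ x y) // (@defect_sym _ _ x.+1) // addnC.
  by apply: h; apply: ltnW.
case: (leqP (y + 2 * b).+1 x) => h1.
  rewrite !defect_right; try lia.
have sqc : (((2 * K - (x.+1 + y)) * (2 * K - (x.+1 + y))) * 2 <=
  (2 * K - (x + y)) * (2 * K - (x + y)) +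
  (2 * K - (x.+1 + y.+1)) * (2 * K - (x.+1 + y.+1)))%N.
  have [u hu] : exists u, u = (2 * K - (x.+1 + y))%N by exists (2 * K - (x.+1 + y))%N.
  rewrite -hu.
  case: u hu => [|u] hu //.
  have ->: (2 * K - (x + y) = u.+2)%N by lia.
  have ->: (2 * K - (x.+1 + y.+1) = u)%N by lia.
  nia.
rewrite (@defect_balanced _ _ x y); try lia.
rewrite (@defect_balanced _ _ x.+1 y.+1); try lia.
apply: leq_trans sqc; rewrite muln2 -addnn leq_add ?defect_le //.
have -> : (x.+1 + y = x + y.+1)%N by lia.
exact: defect_le.
Qed.

Section PairFunctions.
Variable R : realType.

(** These conditions make [F #|S :&: A| #|S :&: B|] a valuation of [S] for disjoint [A] and [B].
    [pair_cross] is symmetric in the two coordinates. *)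
Record pair_submodular (F : nat -> nat -> R) : Prop := PairSubmodular {
  pair_00 : F 0%N 0%N = 0;
  pair_incl : forall x y, F x y <= F x.+1 y;
  pair_incr : forall x y, F x y <= F x y.+1;
  pair_convl : forall x y, F x.+2 y - F x.+1 y <= F x.+1 y - F x y;
  pair_convr : forall x y, F x y.+2 - F x y.+1 <= F x y.+1 - F x y;
  pair_cross : forall x y, F x.+1 y.+1 - F x y.+1 <= F x.+1 y - F x y }.

Lemma homo_nat (f : nat -> R) : (forall k, f k <= f k.+1) ->
  forall x y, (x <= y)%N -> f x <= f y.
Proof.
by move=> h x y xy; apply: (homo_leq (r := fun a b : R => a <= b)) => //; apply: le_trans.
Qed.

Lemma antihomo_nat (f : nat -> R) : (forall k, f k.+1 <= f k) ->
  forall x y, (x <= y)%N -> f y <= f x.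
Proof.
move=> h x y xy; rewrite -lerN2.
by apply: (@homo_nat (fun k => - f k)) => // k; rewrite lerN2.
Qed.

Section Monotone.
Variables (F : nat -> nat -> R) (hF : pair_submodular F).

Lemma pair_mono x y x' y' : (x <= x')%N -> (y <= y')%N -> F x y <= F x' y'.
Proof.
move=> xx' yy'; apply: (@le_trans _ _ (F x' y)).
  by apply: (@homo_nat (F^~ y)) => // k; apply: pair_incl.
by apply: (@homo_nat (F x')) => // k; apply: pair_incr.
Qed.

Lemma pair_marginl x y x' y' : (x <= x')%N -> (y <= y')%N ->
  F x'.+1 y' - F x' y' <= F x.+1 y - F x y.
Proof.
move=> xx' yy'; apply: (@le_trans _ _ (F x'.+1 y - F x' y)).
  by apply: (@antihomo_nat (fun y => F x'.+1 y - F x' y)) => // k; apply: pair_cross.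
by apply: (@antihomo_nat (fun x => F x.+1 y - F x y)) => // k; apply: pair_convl.
Qed.

Lemma pair_marginr x y x' y' : (x <= x')%N -> (y <= y')%N ->
  F x' y'.+1 - F x' y' <= F x y.+1 - F x y.
Proof.
move=> xx' yy'; apply: (@le_trans _ _ (F x y'.+1 - F x y')).
  apply: (@antihomo_nat (fun x => F x y'.+1 - F x y')) => // k.
  by have := pair_cross hF k y'; lra.
by apply: (@antihomo_nat (fun y => F x y.+1 - F x y)) => // k; apply: pair_convr.
Qed.

Variables (m : nat) (A B : {set 'I_m}) (disAB : [disjoint A & B]).

Definition pair_value (S : {set 'I_m}) : R := F #|S :&: A| #|S :&: B|.

Lemma pair_value0 : pair_value finset.set0 = 0.
Proof. by rewrite /pair_value !finset.set0I cards0 pair_00. Qed.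

Lemma pair_value_mono (S T : {set 'I_m}) : S \subset T -> pair_value S <= pair_value T.
Proof. by move=> ST; apply: pair_mono; apply: subset_leq_card; apply: finset.setSI. Qed.

Lemma pair_value_ge0 S : 0 <= pair_value S.
Proof. by rewrite -pair_value0; apply: pair_value_mono; apply: finset.sub0set. Qed.

Lemma cards_setU1I (S C : {set 'I_m}) j : j \notin S ->
  #|(j |: S)%SET :&: C| = ((j \in C) + #|S :&: C|)%N.
Proof.
move=> jS; rewrite finset.setIUl.
have [jC|jC] := boolP (j \in C).
  have -> : [set j]%SET :&: C = [set j]%SET by apply/finset.setIidPl; rewrite finset.sub1set.
  by rewrite cardsU1 finset.in_setI (negbTE jS).
have -> : [set j]%SET :&: C = finset.set0.
  by apply/eqP; rewrite finset.setI_eq0 finset.disjoints1.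
by rewrite finset.set0U.
Qed.

Lemma pair_value_submod (S T : {set 'I_m}) (j : 'I_m) : S \subset T -> j \notin T ->
  pair_value (j |: T)%SET - pair_value T <= pair_value (j |: S)%SET - pair_value S.
Proof.
move=> ST jT; have jS : j \notin S by apply: contra jT; apply/fintype.subsetP.
rewrite /pair_value !cards_setU1I //.
have hA : (#|S :&: A| <= #|T :&: A|)%N by apply: subset_leq_card; apply: finset.setSI.
have hB : (#|S :&: B| <= #|T :&: B|)%N by apply: subset_leq_card; apply: finset.setSI.
have [jA|jA] := boolP (j \in A).
  by rewrite (disjointFr disAB jA) !add0n !add1n; apply: pair_marginl.
rewrite !add0n; have [jB|jB] := boolP (j \in B).
  by rewrite !add1n; apply: pair_marginr.
by rewrite !add0n !subrr.
Qed.

Definition pair_valuation : valuation R m :=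
  Valuation pair_value_ge0 pair_value0 pair_value_mono pair_value_submod.

End Monotone.

Lemma pair_submodular_scale (c : R) F : 0 <= c ->
  pair_submodular F -> pair_submodular (fun x y => c * F x y).
Proof.
move=> c0 [h1 h2 h3 h4 h5 h6]; split; first by rewrite h1 mulr0.
all: by move=> x y; rewrite -?mulrBr ler_wpM2l.
Qed.

Lemma pair_submodular_sum (I : finType) (F : I -> nat -> nat -> R) :
  (forall i, pair_submodular (F i)) ->
  pair_submodular (fun x y => \sum_i F i x y).
Proof.
move=> hF; split=> [|x y|x y|x y|x y|x y]; rewrite -?sumrB.
- by rewrite big1 // => i _; rewrite pair_00.
all: apply: ler_sum => i _.
- exact: pair_incl.
- exact: pair_incr.
- exact: pair_convl.
- exact: pair_convr.
- exact: pair_cross.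
Qed.

(** Equal to [s - s^2 / (4 K)] up to [s = 2 K] and to [K] beyond: a smoothed [minn s K]. *)
Definition smooth_cap (K s : nat) : R :=
  K%:R - ((2 * K - s) * (2 * K - s))%:R / (4 * K)%:R.

Definition hidden_cap (K b x y : nat) : R := K%:R - (defect K b x y)%:R / (4 * K)%:R.

Lemma hidden_cap_submodular K b : (0 < K)%N -> (0 < b)%N ->
  pair_submodular (hidden_cap K b).
Proof.
move=> K0 b0.
have K4 : 0 < (4 * K)%:R :> R by rewrite ltr0n muln_gt0.
have key (a c : nat) : (a <= c)%N -> a%:R / (4 * K)%:R <= c%:R / (4 * K)%:R :> R.
  by move=> ac; rewrite ler_pM2r ?invr_gt0 // ler_nat.
have hx x y : hidden_cap K b x.+2 y - hidden_cap K b x.+1 y <=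
    hidden_cap K b x.+1 y - hidden_cap K b x y.
  have := key _ _ (defect_convex K x y b0); rewrite /hidden_cap natrD natrM mulrDl; lra.
split=> //.
- rewrite /hidden_cap defect_balanced //.
  rewrite !subn0 !natrM; field; rewrite pnatr_eq0; lia.
- by move=> x y; rewrite lerD2l lerN2; apply: key; apply: defect_decr.
- move=> x y; rewrite lerD2l lerN2; apply: key.
  by rewrite !(@defect_sym _ _ x) // defect_decr.
- move=> x y; have := hx y x.
  by rewrite /hidden_cap !(@defect_sym _ _ x).
- move=> x y; have := key _ _ (defect_cross K x y b0).
  rewrite /hidden_cap !natrD !mulrDl; lra.
Qed.

Lemma hidden_cap_balanced K b x y : (x <= y + 2 * b)%N -> (y <= x + 2 * b)%N ->
  hidden_cap K b x y = smooth_cap K (x + y).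
Proof. by move=> h1 h2; rewrite /hidden_cap defect_balanced. Qed.

Lemma hidden_cap_le K b x y : hidden_cap K b x y <= K%:R.
Proof. by rewrite /hidden_cap lerBlDr lerDl divr_ge0. Qed.

(** By monotonicity take [y = 0]; for [x > 2 b] the second factor of the defect is at most [2 K],
    which leaves a function linear in [x] up to the cap. The hidden function thus nearly reaches the
    sharp cap, which [smooth_cap] stays below. *)
Lemma hidden_cap_ge K b x y : (0 < K)%N -> (0 < b)%N ->
  (minn x K)%:R - (2 * b)%:R <= hidden_cap K b x y.
Proof.
move=> K0 b0; have hs := hidden_cap_submodular K0 b0.
apply: le_trans (pair_mono hs (leqnn x) (leq0n y)).
have [xb|xb] := leqP x (2 * b).
  apply: (@le_trans _ _ 0); last first.
    by rewrite -(pair_00 hs); apply: pair_mono.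
  by rewrite subr_le0 ler_nat geq_min xb.
rewrite /hidden_cap defect_right ?add0n 1?ltnW // subn0.
have K4 : 0 < (4 * K)%:R :> R by rewrite ltr0n muln_gt0.
have : ((2 * (K + b - x)) * (2 * (K - b)))%:R / (4 * K)%:R <= (K + b - x)%:R :> R.
  by rewrite ler_pdivrMr // -natrM ler_nat; nia.
have : (minn x K)%:R + (K + b - x)%:R <= K%:R + (2 * b)%:R :> R.
  by rewrite -!natrD ler_nat; lia.
lra.
Qed.

End PairFunctions.

(** * The concave profile and its hidden version *)

Section Mixture.
Variable R : realType.

Lemma concave_ratio (f : nat -> R) : f 0%N = 0 ->
  (forall k, f k.+2 - f k.+1 <= f k.+1 - f k) ->
  forall x y, (0 < x)%N -> (x <= y)%N -> x%:R * f y <= y%:R * f x.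
Proof.
move=> f0 fc.
have step k : k%:R * f k.+1 <= k.+1%:R * f k.
  elim: k => [|k IH]; first by rewrite mul0r f0 mulr0.
  have := ler_wpM2l (ler0n R k.+1) (fc k).
  by move: IH; rewrite -!(natr1 k.+1) -!(natr1 k); lra.
move=> x y x0 xy; rewrite -(subnKC xy).
elim: (y - x)%N => [|k IH]; first by rewrite addn0.
rewrite addnS; have y0 : 0 < (x + k)%:R :> R by rewrite ltr0n ltn_addr.
rewrite -(ler_pM2l y0) mulrCA.
apply: (le_trans (ler_wpM2l (ler0n R x) (step _))).
by rewrite mulrCA (mulrCA (x + k)%:R) ler_wpM2l.
Qed.

(** Scales [2^a <= s] contribute about [(7/4)^a] and larger ones about [s (7/8)^a], so up to [2^L]
    this behaves like the power of [s] with exponent [log2 (7/4)]. *)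
Definition phi (L s : nat) : R := \sum_(a < L) (7 / 8) ^+ a * smooth_cap R (2 ^ a) s.

Definition hidden_phi (b L x y : nat) : R :=
  \sum_(a < L) (7 / 8) ^+ a * hidden_cap R (2 ^ a) b x y.

Lemma ratio_ge0 a : 0 <= (7 / 8) ^+ a :> R.
Proof. by rewrite exprn_ge0 // divr_ge0. Qed.

Lemma hidden_phi_submodular b L : (0 < b)%N -> pair_submodular (hidden_phi b L).
Proof.
move=> b0; apply: pair_submodular_sum => a; apply: pair_submodular_scale.
  exact: ratio_ge0.
by apply: hidden_cap_submodular => //; rewrite expn_gt0.
Qed.

Lemma hidden_phi_balanced b L x y : (x <= y + 2 * b)%N -> (y <= x + 2 * b)%N ->
  hidden_phi b L x y = phi L (x + y).
Proof. by move=> h1 h2; apply: eq_bigr => a _; rewrite hidden_cap_balanced. Qed.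

(** For [b] this large the pair [(x, 0)] is balanced, so [phi] inherits monotonicity and concavity
    from [hidden_phi]. *)
Lemma phiE b L x : (x <= 2 * b)%N -> phi L x = hidden_phi b L x 0.
Proof. by move=> h; rewrite hidden_phi_balanced // addn0. Qed.

Lemma phi0 L : phi L 0 = 0.
Proof. by rewrite (@phiE 1) // pair_00 //; apply: hidden_phi_submodular. Qed.

Lemma phi_concave L x : phi L x.+2 - phi L x.+1 <= phi L x.+1 - phi L x.
Proof. by rewrite !(@phiE x.+1) //; [apply: pair_convl; apply: hidden_phi_submodular|lia..]. Qed.

Lemma phi_incr L x : phi L x <= phi L x.+1.
Proof. by rewrite !(@phiE x.+1) //; [apply: pair_incl; apply: hidden_phi_submodular|lia..]. Qed.

Lemma phi_submodular L : pair_submodular (fun x _ => phi L x).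
Proof.
split=> *; rewrite ?subrr ?phi0 //; by [exact: phi_incr|exact: phi_concave].
Qed.

Lemma phi_ge0 L x : 0 <= phi L x.
Proof. by rewrite -(phi0 L); apply: homo_nat => // k; apply: phi_incr. Qed.

Lemma sum_ratio_le n : \sum_(a < n) (7 / 8) ^+ a <= 8 :> R.
Proof.
suff : \sum_(a < n) (7 / 8) ^+ a <= 8 - 8 * (7 / 8) ^+ n :> R.
  by have := ratio_ge0 n; lra.
elim: n => [|n IH]; first by rewrite big_ord0 expr0; lra.
by rewrite big_ord_recr /= exprS; lra.
Qed.

Lemma hidden_phi_le b L x y : hidden_phi b L x y <= 2 ^+ L.
Proof.
apply: (@le_trans _ _ (\sum_(a < L) 2 ^+ a)).
  apply: ler_sum => a _; apply: le_trans (ler_wpM2l (ratio_ge0 a) (hidden_cap_le R _ _ _ _)) _.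
  rewrite natrX ler_piMl ?exprn_ge0 // exprn_ile1 //; lra.
elim: L => [|L IH]; first by rewrite big_ord0.
by rewrite big_ord_recr /= exprS; lra.
Qed.

Lemma smooth_cap_le K x : (0 < K)%N -> smooth_cap R K x <= (minn x K)%:R.
Proof.
move=> K0; rewrite /smooth_cap.
have K4 : 0 < (4 * K)%:R :> R by rewrite ltr0n muln_gt0.
rewrite lerBlDr -lerBlDl ler_pdivlMr //.
have [xK|xK] := leqP x K.
  have -> : K%:R - x%:R = (K - x)%:R :> R by rewrite natrB.
  rewrite -natrM ler_nat; have [u ->] : exists u, K = (x + u)%N by exists (K - x)%N; lia.
  have -> : (x + u - x = u)%N by lia.
  have -> : (2 * (x + u) - x = x + 2 * u)%N by lia.
  nia.
by rewrite subrr mul0r.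
Qed.

(** In this range the smooth cap is [x - x^2 / (8 K)], and [x >= K] makes the loss at least
    [K / 8]. *)
Lemma smooth_cap_gap K x : (K <= x)%N -> (x < 2 * K)%N ->
  smooth_cap R (2 * K) x + K%:R / 8 <= (minn x (2 * K))%:R.
Proof.
move=> h1 h2; rewrite (minn_idPl (ltnW h2)) /smooth_cap.
have K4 : 0 < (4 * (2 * K))%:R :> R by rewrite ltr0n; lia.
set q := (2 * (2 * K) - x)%N.
have h : 8 * K%:R * (2 * K%:R) + K%:R * K%:R <= q%:R * q%:R + 8 * K%:R * x%:R :> R.
  rewrite -!natrM -!natrD ler_nat /q.
  have [u hu] : exists u, x = (K + u)%N by exists (x - K)%N; lia.
  subst x.
  have [v hv] : exists v, K = (u + v)%N by exists (K - u)%N; lia.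
  have -> : (2 * (2 * K) - (K + u) = 2 * u + 3 * v)%N by lia.
  by rewrite hv; nia.
have K0 : 0 < K%:R :> R by rewrite ltr0n; lia.
rewrite -(ler_pM2l K0) !natrM.
have : q%:R * q%:R / (4%:R * (2%:R * K%:R)) * (8%:R * K%:R) = q%:R * q%:R :> R.
  by field; rewrite gt_eqF.
set D := _ / _; nra.
Qed.

Lemma phi_pow_ge L e : (e < L)%N -> 3 / 4 * (7 / 4) ^+ e <= phi L (2 ^ e).
Proof.
move=> eL; rewrite /phi (bigD1 (Ordinal eL)) //=.
rewrite -[leLHS]addr0 lerD //.
  rewrite /smooth_cap (_ : 2 * 2 ^ e - 2 ^ e = 2 ^ e)%N; last lia.
  rewrite !natrM natrX (_ : 2 ^+ e - 2 ^+ e * 2 ^+ e / (4 * 2 ^+ e) = 3 / 4 * 2 ^+ e :> R).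
    by rewrite mulrCA -exprMn (_ : 7 / 8 * 2 = 7 / 4 :> R) //; field.
  by field; rewrite expf_neq0 // pnatr_eq0.
apply: sumr_ge0 => a _; rewrite mulr_ge0 ?ratio_ge0 //.
have hs := @hidden_cap_submodular R (2 ^ a) (2 ^ e) _ _.
rewrite -[X in smooth_cap _ _ X]addn0 -(@hidden_cap_balanced R _ (2 ^ e)); try lia.
rewrite -(pair_00 (hs _ _)) ?expn_gt0 //; apply: pair_mono => //.
by apply: hs; rewrite expn_gt0.
Qed.

(** The mixture [phi] with sharp caps, which [hidden_phi] attains on the hidden half up to a small
    error. *)
Definition cap_sum (n x : nat) : R := \sum_(a < n) (7 / 8) ^+ a * (minn x (2 ^ a))%:R.

(** Two geometric sums: scales up to [e] give at most [4/3 (7/4)^(e+1) = 7/3 (7/4)^e], larger ones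
    at most [8 (7/4)^(e+1) = 14 (7/4)^e]. *)
Lemma cap_sum_le n e x : (x < 2 ^ e.+1)%N -> cap_sum n x <= 17 * (7 / 4) ^+ e.
Proof.
move=> hx.
have e0 : 0 <= (7 / 4) ^+ e :> R by rewrite exprn_ge0 // divr_ge0.
have small k : cap_sum k x <= 4 / 3 * (7 / 4) ^+ k.
  elim: k => [|k IH]; first by rewrite /cap_sum big_ord0 expr0; lra.
  rewrite /cap_sum big_ord_recr /= -/(cap_sum k x) exprS.
  have : (7 / 8) ^+ k * (minn x (2 ^ k))%:R <= (7 / 4) ^+ k :> R.
    rewrite (_ : 7 / 4 = 7 / 8 * 2 :> R); last by field.
  by rewrite (exprMn k (7 / 8) 2) ler_wpM2l ?ratio_ge0 // -natrX ler_nat geq_minr.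
  lra.
have big k : cap_sum (e.+1 + k) x <=
    7 / 3 * (7 / 4) ^+ e + 14 * (7 / 4) ^+ e * (1 - (7 / 8) ^+ k).
  elim: k => [|k IH].
    by rewrite addn0 expr0 subrr mulr0 addr0; have := small e.+1; rewrite exprS; lra.
  rewrite addnS /cap_sum big_ord_recr /= -/(cap_sum (e.+1 + k) x).
  have : (7 / 8) ^+ (e.+1 + k) * (minn x (2 ^ (e.+1 + k)))%:R <=
      14 / 8 * (7 / 4) ^+ e * (7 / 8) ^+ k :> R.
    apply: (@le_trans _ _ ((7 / 8) ^+ (e.+1 + k) * (2 ^ e.+1)%:R)).
      by rewrite ler_wpM2l ?ratio_ge0 // ler_nat geq_min (ltnW hx).
    rewrite (_ : 7 / 4 = 7 / 8 * 2 :> R); last by field.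
    rewrite natrX (exprMn e (7 / 8) 2) addSn exprS exprD (exprS 2).
    by rewrite le_eqVlt; apply/orP; left; apply/eqP; field.
  have := IH; rewrite exprS; lra.
have [ne|ne] := leqP n e.+1.
  apply: (le_trans (small n)).
  have : (7 / 4) ^+ n <= (7 / 4) ^+ e.+1 :> R by apply: ler_weXn2l ne; lra.
  rewrite exprS; lra.
have := big (n - e.+1)%N; rewrite subnKC; last exact: ltnW.
have := mulr_ge0 e0 (ratio_ge0 (n - e.+1)); lra.
Qed.

(* The first scale above [x] alone contributes a difference [7/64 (7/4)^e], against a
   total of at most [17 (7/4)^e]. *)
Lemma cap_sum_ge L x : (x < 2 ^ L)%N -> 161 / 160 * phi L.+1 x <= cap_sum L.+1 x.
Proof.
case: x => [|x] hx.
  rewrite phi0 mulr0; apply: sumr_ge0 => a _; rewrite mulr_ge0 ?ratio_ge0 //.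
have [e /andP[e1 e2]] : exists e, (2 ^ e <= x.+1 < 2 ^ e.+1)%N.
  by exists (trunc_log 2 x.+1); apply: trunc_log_bounds.
have eL : (e.+1 < L.+1)%N.
  by rewrite ltnS -(@ltn_exp2l 2) //; apply: leq_ltn_trans hx.
have := cap_sum_le L.+1 e2.
have e0 : 0 <= (7 / 4) ^+ e :> R by rewrite exprn_ge0 // divr_ge0.
suff : phi L.+1 x.+1 + 7 / 64 * (7 / 4) ^+ e <= cap_sum L.+1 x.+1 by lra.
rewrite /phi /cap_sum (bigD1 (Ordinal eL)) //=.
rewrite (bigD1 (Ordinal eL) (F := fun a : 'I_ _ => _ * (minn _ _)%:R)) //=.
rewrite addrAC lerD //.
  have := smooth_cap_gap e1 _; rewrite -expnS => /(_ e2) h.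
  have := ler_wpM2l (ratio_ge0 e.+1) h.
  rewrite mulrDr; suff -> : (7 / 8) ^+ e.+1 * ((2 ^ e)%:R / 8) = 7 / 64 * (7 / 4) ^+ e :> R by [].
  rewrite (_ : 7 / 4 = 7 / 8 * 2 :> R); last by field.
  by rewrite natrX (exprMn e (7 / 8) 2) exprS; field.
apply: ler_sum => a _; rewrite ler_wpM2l ?ratio_ge0 //.
by apply: smooth_cap_le; rewrite expn_gt0.
Qed.

(** Each cap loses [2 b] and the weights sum to at most 8, whence the error [16 b]. The factor
    161/160 is the gain kappa of one hiding step. *)
Lemma hidden_phi_ge b L x y : (0 < b)%N -> (x < 2 ^ L)%N ->
  161 / 160 * phi L.+1 x - (16 * b)%:R <= hidden_phi b L.+1 x y.
Proof.
move=> b0 hx; apply: (@le_trans _ _ (cap_sum L.+1 x - (16 * b)%:R)).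
  by rewrite lerD2r cap_sum_ge.
apply: (@le_trans _ _ (\sum_(a < L.+1) ((7 / 8) ^+ a * ((minn x (2 ^ a))%:R - (2 * b)%:R)))).
  under [leRHS]eq_bigr do rewrite mulrBr.
  rewrite sumrB lerD2l lerN2 -mulr_suml.
  have := ler_wpM2r (ler0n R (2 * b)) (sum_ratio_le L.+1).
  by rewrite -natrM mulnA.
apply: ler_sum => a _; rewrite ler_wpM2l ?ratio_ge0 //.
by apply: hidden_cap_ge => //; rewrite expn_gt0.
Qed.

(** Monotonicity up to [K], concavity beyond. The bound is affine in [x], so it can be summed over
    disjoint bundles. *)
Lemma phi_upper L K x : (0 < K)%N -> phi L x <= phi L K * (1 + x%:R / K%:R).
Proof.
move=> K0; have K0' : 0 < K%:R :> R by rewrite ltr0n.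
have [xK|xK] := leqP x K.
  apply: (@le_trans _ _ (phi L K)); first by apply: homo_nat => // k; apply: phi_incr.
  by rewrite ler_peMr ?phi_ge0 // lerDl divr_ge0.
have := concave_ratio (phi0 L) (phi_concave L) K0 (ltnW xK).
rewrite mulrC -ler_pdivlMr // => h; apply: (le_trans h).
by rewrite mulrDr mulr1 mulrA (mulrC x%:R) lerDr phi_ge0.
Qed.

(** With [z = x / K], concavity gives the factor [z] for [z <= 1], and [z - z^2 / 4 <= 1] always.
    For random [x] the quadratic form leaves only two moments to estimate. *)
Lemma phi_lower L K x : (0 < K)%N ->
  phi L K * (x%:R / K%:R - (x%:R / K%:R) ^+ 2 / 4) <= phi L x.
Proof.
move=> K0; have K0' : 0 < K%:R :> R by rewrite ltr0n.
have [xK|xK] := leqP x K; last first.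
  apply: (@le_trans _ _ (phi L K)); last first.
    by apply: homo_nat (ltnW xK) => // k; apply: phi_incr.
  rewrite ler_piMr ?phi_ge0 //; set z := _ / _.
  have := sqr_ge0 (z / 2 - 1); lra.
case: x xK => [|x] xK; first by rewrite mul0r expr0n /= mul0r subr0 mulr0 phi_ge0.
have := concave_ratio (phi0 L) (phi_concave L) (ltn0Sn x) xK.
rewrite mulrC (mulrC K%:R) -ler_pdivrMr // => h; apply: le_trans h.
by rewrite -[leRHS]mulrA ler_wpM2l ?phi_ge0 // lerBlDr lerDl divr_ge0 // sqr_ge0.
Qed.

End Mixture.

(** * Random halves *)

Section Balance.
Variables (R : realType) (m : nat).

Definition balanced (b : nat) (S B : {set 'I_m}) : bool :=
  (#|S :&: B| <= #|S :\: B| + 2 * b)%N && (#|S :\: B| <= #|S :&: B| + 2 * b)%N.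

Lemma bernoulli (x : R) n : 0 <= x -> 1 + n%:R * x <= (1 + x) ^+ n.
Proof.
move=> x0; elim: n => [|n IH]; first by rewrite mul0r addr0 expr0.
rewrite exprS -natr1; have := ler_wpM2l (addr_ge0 ler01 x0) IH.
have := mulr_ge0 (mulr_ge0 (ler0n R n) x0) x0; nra.
Qed.

Lemma bernoulli_upper (x : R) n : 0 <= x -> n%:R * x <= 1 / 2 -> (1 + x) ^+ n <= 2.
Proof.
move=> x0 nx; have p0 : 0 <= (1 + x) ^+ n by rewrite exprn_ge0 // addr_ge0.
suff : (1 + x) ^+ n * (1 - n%:R * x) <= 1 by have := ler_wpM2l p0 nx; lra.
elim: n {nx p0} => [|n IH]; first by rewrite expr0 mul0r subr0 mulr1.
apply: le_trans IH; rewrite exprS -mulrA [leLHS]mulrCA ler_wpM2l ?exprn_ge0 ?addr_ge0 //.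
rewrite -natr1; have := mulr_ge0 (mulr_ge0 (ler0n R n) x0) x0; have := mulr_ge0 x0 x0; nra.
Qed.

(** An exponential moment of a random [B] factors over the items: [a + c] for an item of [S], 2 for
    any other. *)
Lemma sum_tilt (S : {set 'I_m}) (a c : R) :
  \sum_(B : {set 'I_m}) a ^+ #|S :&: B| * c ^+ #|S :\: B| =
  (a + c) ^+ #|S| * 2 ^+ (m - #|S|).
Proof.
have E := @bigA_distr _ 0 1 *%R +%R 'I_m (fun u => if u \in S then a else 1)
  (fun u => if u \in S then c else 1).
transitivity (\prod_(u < m) (if u \in S then a + c else 2)).
  transitivity (\sum_(B : {set 'I_m}) \prod_(u < m)
     (if u \in B then (if u \in S then a else 1) else (if u \in S then c else 1))).
    apply: eq_bigr => B _.
    rewrite -prodr_const -(prodr_const (mem (S :\: B))).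
    rewrite big_mkcond [X in _ * X]big_mkcond -big_split /=; apply: eq_bigr => u _.
    rewrite !finset.inE; case: (u \in B); case: (u \in S) => /=; by rewrite ?mulr1 ?mul1r.
  have := E; rewrite /= => <-; apply: eq_bigr => u _; case: ifP => //.
rewrite (bigID (mem S)) /=; congr (_ * _).
  by rewrite -prodr_const; apply: eq_bigr => u ->.
rewrite (eq_bigr (fun=> 2)); last by move=> u /negbTE ->.
rewrite prodr_const; congr (_ ^+ _).
rewrite -[X in (X - _)%N](card_ord m) -(cardC (mem S)) addKn.
by apply: eq_card => u; rewrite !inE.
Qed.

(** Exponential Markov inequality with base [1 + 1/w]: an excess of [2 w t] has weight at least
    [4^t] because [(1 + 1/w)^w >= 2], while the average weight is at most
    [(1 + 1/(2 w^2))^#|S| <= 2]. Abstract [p] and [q] serve both tails. *)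
Lemma tail_count (w t : nat) (S : {set 'I_m}) (p q : {set 'I_m} -> nat) :
  (0 < w)%N -> (#|S| <= w * w)%N ->
  (forall a c : R, \sum_(B : {set 'I_m}) a ^+ p B * c ^+ q B =
     (a + c) ^+ #|S| * 2 ^+ (m - #|S|)) ->
  #|[set B | (q B + 2 * (w * t) < p B)%N]%SET|%:R * 4 ^+ t <= 2 * 2 ^+ m :> R.
Proof.
move=> w0 Sw sumE.
have w0' : 0 < w%:R :> R by rewrite ltr0n.
pose e : R := w%:R^-1; have e0 : 0 < e by rewrite invr_gt0.
have a0 : 0 < 1 + e by rewrite addr_gt0.
apply: (@le_trans _ _ (\sum_(B : {set 'I_m}) (1 + e) ^+ p B * (1 + e)^-1 ^+ q B)).
  rewrite mulr_natl -sumr_const [leRHS](bigID (mem [set B | (q B + 2 * (w * t) < p B)%N]%SET)) /=.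
  rewrite -[leLHS]addr0; apply: lerD; last first.
    by apply: sumr_ge0 => B _; rewrite mulr_ge0 // exprn_ge0 // ?invr_ge0; apply: ltW.
  apply: ler_sum => B; rewrite finset.inE => hB.
  apply: (@le_trans _ _ ((1 + e) ^+ (2 * (w * t)))).
    rewrite mulnCA exprM exprM lerXn2r ?nnegrE ?exprn_ge0 //.
      exact: ltW.
    have : 2 <= (1 + e) ^+ w.
      by have := bernoulli w (ltW e0); rewrite /e divff ?gt_eqF //; lra.
    by rewrite expr2; nra.
  rewrite exprVn ler_pdivlMr ?exprn_gt0 // -exprD.
  by apply: ler_weXn2l; [rewrite lerDl ltW|rewrite addnC ltnW].
rewrite sumE.
have le2 : 1 + e + (1 + e)^-1 <= 2 * (1 + e ^+ 2 / 2).
  rewrite -(ler_pM2r a0) mulrDl mulVf ?gt_eqF //.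
  have := mulr_gt0 (mulr_gt0 e0 e0) e0; nra.
apply: (@le_trans _ _ ((2 * (1 + e ^+ 2 / 2)) ^+ #|S| * 2 ^+ (m - #|S|))).
  rewrite ler_wpM2r ?exprn_ge0 // lerXn2r ?nnegrE //.
    by rewrite addr_ge0 ?invr_ge0 // ltW.
  by rewrite mulr_ge0 // addr_ge0 // divr_ge0 // sqr_ge0.
rewrite exprMn mulrAC -exprD subnKC; last first.
  by rewrite -[X in (_ <= X)%N](card_ord m); apply: max_card.
rewrite mulrC ler_wpM2r ?exprn_ge0 //.
apply: bernoulli_upper; first by rewrite divr_ge0 // sqr_ge0.
rewrite mulrA ler_pdivrMr // divfK ?pnatr_eq0 // /e exprVn ler_pdivrMr ?exprn_gt0 //.
by rewrite mul1r expr2 -natrM ler_nat.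
Qed.

(* Hoeffding's inequality, for the deviation [2 w t] of a sum of [|S| <= w^2] signs. *)
Lemma unbalanced_count (w t : nat) (S : {set 'I_m}) : (0 < w)%N -> (#|S| <= w * w)%N ->
  #|[set B | ~~ balanced (w * t) S B]%SET|%:R * 4 ^+ t <= 4 * 2 ^+ m :> R.
Proof.
move=> w0 Sw.
have h1 := tail_count t w0 Sw (sum_tilt S).
have h2 : #|[set B | (#|S :&: B| + 2 * (w * t) < #|S :\: B|)%N]%SET|%:R * 4 ^+ t <= 2 * 2 ^+ m :> R.
  apply: (tail_count t w0 Sw) => a c; rewrite addrC -sum_tilt.
  by apply: eq_bigr => B _; rewrite mulrC.
apply: (@le_trans _ _ (2 * 2 ^+ m + 2 * 2 ^+ m)); last by lra.
apply: le_trans (lerD h1 h2); rewrite -mulrDl ler_wpM2r ?exprn_ge0 // -natrD ler_nat.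
apply: leq_trans (leq_card_setU _ _); apply: subset_leq_card.
apply/fintype.subsetP => B; rewrite !finset.inE /balanced negb_and -!ltnNge; lia.
Qed.

End Balance.

(** * Expectations and value queries *)

Section Expectations.
Variables (R : realType) (n m : nat) (M : mechanism R n m).
Implicit Types (v : profile R n m) (g : allocation n m -> R).

Local Open Scope classical_set_scope.

Definition alloc_prob v (S : allocation n m) : R :=
  fine (coin_law M [set w | alloc_rule M v w = S]).

(** There are finitely many allocations, so an expectation over the coins is a finite sum. *)
Definition mean_alloc v g : R := \sum_S g S * alloc_prob v S.

Definition mean_payment v i : R := fine ('E_(coin_law M)[payment_rule M v i])%E.

Lemma alloc_fun_sum v g :
  (fun w => g (alloc_rule M v w)) =
  \sum_(X <- [seq (g A) \o* \1_[set w | alloc_rule M v w = A] | A : allocation n m]) X.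
Proof.
apply/funext => w; rewrite fct_sumE big_map big_enum /= (bigD1 (alloc_rule M v w)) //=.
rewrite big1 ?addr0; last first.
  move=> S /eqP neq; rewrite indicE memNset ?mul0r //=; exact/nesym.
by rewrite indicE mem_set //= mul1r.
Qed.

Lemma indic_Lfun v S : \1_[set w | alloc_rule M v w = S] \in Lfun (coin_law M) 1%E.
Proof.
apply/Lfun1_integrable; apply: integrable_indic; exact: alloc_rule_measurable.
Qed.

Lemma alloc_fun_Lfun v g : (fun w => g (alloc_rule M v w)) \in Lfun (coin_law M) 1%E.
Proof.
rewrite alloc_fun_sum big_map; apply: rpred_sum => S _.
by apply: Lfun_scale => //; apply: indic_Lfun.
Qed.

Lemma expectation_alloc v g :
  'E_(coin_law M)[fun w => g (alloc_rule M v w)]%E = (mean_alloc v g)%:E.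
Proof.
rewrite alloc_fun_sum expectation_sum; last first.
  move=> X /mapP[S _ ->]; apply: Lfun_scale => //; exact: indic_Lfun.
rewrite big_map big_enum /= /mean_alloc -sumEFin; apply: eq_bigr => S _.
rewrite expectationZl; last exact: indic_Lfun.
rewrite expectation_indic; last exact: alloc_rule_measurable.
rewrite EFinM fineK // fin_num_measure //; exact: alloc_rule_measurable.
Qed.

Lemma payment_Lfun v i : payment_rule M v i \in Lfun (coin_law M) 1%E.
Proof. by apply/Lfun1_integrable; apply: payment_rule_integrable. Qed.

Lemma expectation_payment v i :
  'E_(coin_law M)[payment_rule M v i]%E = (mean_payment v i)%:E.
Proof. by rewrite fineK // expectation_fin_num // payment_Lfun. Qed.

Definition mean_value (u : valuation R m) v i : R := mean_alloc v (fun S => u (S i)).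

Lemma expected_utilityE (u : valuation R m) v i :
  expected_utility M u v i = (mean_value u v i - mean_payment v i)%:E.
Proof.
rewrite /expected_utility EFinB -expectation_payment -expectation_alloc.
by rewrite -(expectationB (alloc_fun_Lfun v (fun S => u (S i))) (payment_Lfun v i)).
Qed.

Lemma alloc_prob_ge0 v S : 0 <= alloc_prob v S.
Proof. by rewrite fine_ge0. Qed.

Lemma mean_alloc_le v g h : (forall S, g S <= h S) -> mean_alloc v g <= mean_alloc v h.
Proof. by move=> gh; apply: ler_sum => S _; rewrite ler_wpM2r ?alloc_prob_ge0. Qed.

Lemma mean_allocZ v c g : mean_alloc v (fun S => c * g S) = c * mean_alloc v g.
Proof. by rewrite mulr_sumr; apply: eq_bigr => S _; rewrite mulrA. Qed.

Lemma mean_allocB v g h : mean_alloc v (fun S => g S - h S) = mean_alloc v g - mean_alloc v h.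
Proof. by rewrite -sumrB; apply: eq_bigr => S _; rewrite mulrBl. Qed.

Lemma mean_alloc_sum (I : finType) v (P : pred I) (g : I -> allocation n m -> R) :
  mean_alloc v (fun S => \sum_(i | P i) g i S) = \sum_(i | P i) mean_alloc v (g i).
Proof.
by rewrite exchange_big; apply: eq_bigr => S _; rewrite mulr_suml.
Qed.

(* The coins are shared by all the profiles, so a bound valid for every
   outcome of the coins passes to the sum of the means. *)
Lemma mean_alloc_coupling (K : finType) (v : K -> profile R n m)
    (g : K -> allocation n m -> R) (C : R) :
  (forall w, \sum_k g k (alloc_rule M (v k) w) <= C) ->
  \sum_k mean_alloc (v k) (g k) <= C.
Proof.
move=> h; rewrite -lee_fin -sumEFin.
under eq_bigr do rewrite -expectation_alloc.
pose X (k : K) := (fun w => g k (alloc_rule M (v k) w)).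
have -> : (\sum_(k : K) 'E_(coin_law M)[fun w => g k (alloc_rule M (v k) w)] =
   'E_(coin_law M)[\sum_(Y <- [seq X k | k : K]) Y])%E.
  rewrite expectation_sum; first by rewrite big_map big_enum.
  by move=> Y /mapP[k _ ->]; apply: alloc_fun_Lfun.
have XL : \sum_(Y <- [seq X k | k : K]) Y \in Lfun (coin_law M) 1%E.
  by rewrite big_map; apply: rpred_sum => k _; apply: alloc_fun_Lfun.
rewrite -(expectation_cst (coin_law M)) unlock; apply: le_integral => //.
- exact/Lfun1_integrable.
- exact/Lfun1_integrable/Lfun_cst.
move=> w _; rewrite lee_fin fct_sumE big_map big_enum /=; exact: h.
Qed.

Lemma mean_alloc_cst v C : mean_alloc v (fun=> C) = C.
Proof.
have /eqP := expectation_alloc v (fun=> C).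
by rewrite (expectation_cst (coin_law M)) eqe => /eqP.
Qed.

End Expectations.

Section Queries.
Variables (R : realType) (n m : nat).

Fixpoint queries (t : query_tree R n m) (v : profile R n m) : seq ('I_n * {set 'I_m}) :=
  match t with
  | Output _ _ => [::]
  | Query i Q k => (i, Q) :: queries (k (v i Q)) v
  end.

Lemma size_queries t v : size (queries t v) = num_queries t v.
Proof. by elim: t => //= i Q k IH; rewrite IH. Qed.

(** The run branches only on answers, so equal answers to the queries made on [v] force the same
    path on [v']. *)
Lemma run_agree t (v v' : profile R n m) :
  (forall i Q, (i, Q) \in queries t v -> v' i Q = v i Q) -> run t v' = run t v.
Proof.
elim: t => //= i Q k IH agree.
have E : v' i Q = v i Q by apply: agree; rewrite mem_head.
rewrite E; apply: IH => j P jP; apply: agree; rewrite inE jP orbT.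
by [].
Qed.

End Queries.

(** * Truthfulness along a chain of hidden sets *)

Lemma card_sets m : #|{: {set 'I_m}}| = (2 ^ m)%N.
Proof. by rewrite -cardsT -powersetT card_powerset cardsT card_ord. Qed.

Lemma sum_sets_const (R : realType) m (x : R) : \sum_(B : {set 'I_m}) x = 2 ^+ m * x.
Proof. by rewrite sumr_const card_sets -[LHS]mulr_natl natrX. Qed.

Section Valuations.
Variables (R : realType) (m L : nat).

Lemma disjoint_split (A B : {set 'I_m}) : [disjoint A :&: B & A :\: B].
Proof.
rewrite -finset.setI_eq0; apply/eqP/finset.setP => u; rewrite !finset.inE.
by case: (u \in B); rewrite ?andbF.
Qed.

Lemma disjoint_empty (A : {set 'I_m}) : [disjoint A & finset.set0].
Proof. by rewrite -finset.setI_eq0 finset.setI0. Qed.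

Definition shade (c : R) (c0 : 0 <= c) (A : {set 'I_m}) : valuation R m :=
  pair_valuation (pair_submodular_scale c0 (phi_submodular R L)) (disjoint_empty A).

Definition hidden_shade (b : nat) (b0 : (0 < b)%N) (c : R) (c0 : 0 <= c)
    (A B : {set 'I_m}) : valuation R m :=
  pair_valuation (pair_submodular_scale c0 (hidden_phi_submodular R L b0))
    (disjoint_split A B).

Lemma shadeE (c : R) (c0 : 0 <= c) A S : shade c0 A S = c * phi R L #|S :&: A|.
Proof. by []. Qed.

Lemma hidden_shade_balanced b (b0 : (0 < b)%N) (c : R) (c0 : 0 <= c) A B S :
  balanced b (S :&: A) B -> hidden_shade b0 c0 A B S = shade c0 A S.
Proof.
move=> /andP[h1 h2]; rewrite /hidden_shade /shade /= /pair_value.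
rewrite finset.setIA finset.setIDA hidden_phi_balanced //.
by rewrite (cardsID B (S :&: A)).
Qed.

Lemma hidden_shade_le b (b0 : (0 < b)%N) (c : R) (c0 : 0 <= c) A B S :
  hidden_shade b0 c0 A B S <= c * 2 ^+ L.
Proof. by rewrite ler_wpM2l // hidden_phi_le. Qed.

Lemma hidden_shade_ge b (b0 : (0 < b)%N) (c c' : R) (c0 : 0 <= c) (c0' : 0 <= c') A B S :
  c' = 161 / 160 * c -> (0 < L)%N -> (m < 2 ^ L.-1)%N ->
  shade c0' (A :&: B) S - c * (16 * b)%:R <= hidden_shade b0 c0 A B S.
Proof.
move=> cE L0 mL; subst c'; rewrite /hidden_shade /shade /= /pair_value.
set x := #|S :&: (A :&: B)|.
have hx : (x < 2 ^ L.-1)%N.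
  by apply: leq_ltn_trans mL; rewrite -[X in (_ <= X)%N](card_ord m); apply: max_card.
have := ler_wpM2l c0 (hidden_phi_ge R #|S :&: (A :\: B)| b0 hx).
by rewrite prednK // mulrBr; lra.
Qed.

End Valuations.

Section Chain.
Variables (R : realType) (n m : nat) (M : mechanism R n m) (eps : R) (q : nat).
Hypothesis eps0 : 0 <= eps.
Hypothesis eps1 : eps <= 1.
Hypothesis rational : individually_rational M.
Hypothesis payments : nonneg_payments M.
Hypothesis truthful : approx_truthful M eps.
Hypothesis few_queries : queries_at_most M q.

Definition report (v : profile R n m) (i : 'I_n) (u : valuation R m) : profile R n m :=
  [eta v with i |-> u].

Lemma report_same v i u : report v i u i = u.
Proof. by rewrite /report /= eqxx. Qed.

Lemma report_other v i u j : j != i -> report v i u j = v j.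
Proof. by rewrite /report /= => /negbTE ->. Qed.

Lemma report_report v i u u' : report (report v i u) i u' = report v i u'.
Proof. by apply/funext => j; rewrite /report /=; case: (j == i). Qed.

Definition utility v i (u u' : valuation R m) : R :=
  mean_value M u (report v i u') i - mean_payment M (report v i u') i.

Lemma utility_truthful v i u u' : (1 - eps) * utility v i u u' <= utility v i u u.
Proof.
have := truthful (report v i u) i u'; rewrite report_same !expected_utilityE.
by rewrite -/(report (report v i u) i u') report_report -EFinM lee_fin.
Qed.

Lemma utility_ge0 v i u : 0 <= utility v i u u.
Proof.
by have := rational (report v i u) i; rewrite report_same expected_utilityE lee_fin.
Qed.

Lemma utility_le v i u u' : utility v i u u' <= mean_value M u (report v i u') i.
Proof.
have := payments (report v i u') i; rewrite expectation_payment lee_fin.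
by rewrite /utility; lra.
Qed.

Variables (L w t : nat).
Hypothesis w0 : (0 < w)%N.
Hypothesis t0 : (0 < t)%N.
Hypothesis m_le : (m <= w * w)%N.
Hypothesis L0 : (0 < L)%N.
Hypothesis m_lt : (m < 2 ^ L.-1)%N.

Let b := (w * t)%N.
Let b0 : (0 < b)%N. Proof. by rewrite muln_gt0 w0. Qed.

(** Union bound over at most [q] queried sets and one output bundle, each unbalanced with
    probability at most [4 / 4^t]; a failure costs at most [2^L], the bound on [hidden_phi]. *)
Definition hiding_error : R := 2 ^+ L * (q.+1%:R * (4 / 4 ^+ t)).

Lemma hiding_error_ge0 : 0 <= hiding_error.
Proof. by rewrite !mulr_ge0 ?exprn_ge0 // divr_ge0 // exprn_ge0. Qed.

(** Fix the coins. The run on the shade of [A] does not depend on [B]; if [B] splits evenly its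
    queries and its bundle for player [i], the run on the hidden valuation is the same and both
    valuations agree on that bundle. *)
Lemma hidden_close v i (c : R) (c0 : 0 <= c) A :
  \sum_(B : {set 'I_m})
    (mean_value M (hidden_shade L b0 c0 A B) (report v i (hidden_shade L b0 c0 A B)) i
     - mean_value M (shade L c0 A) (report v i (hidden_shade L b0 c0 A B)) i)
  <= 2 ^+ m * (c * hiding_error).
Proof.
under eq_bigr do rewrite -mean_allocB.
apply: mean_alloc_coupling => w'.
pose tr := algorithm M w'; pose v0 := report v i (shade L c0 A).
(* The output bundle counts as one more set, whence [q.+1]. *)
pose sets := (run tr v0).1 i :: [seq x.2 | x <- queries tr v0].
pose bad (B : {set 'I_m}) (Q : {set 'I_m}) := ~~ balanced b (Q :&: A) B.
have C0 : 0 <= c * 2 ^+ L by rewrite mulr_ge0 // exprn_ge0.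
apply: (@le_trans _ _ (\sum_(B : {set 'I_m}) \sum_(Q <- sets) (bad B Q)%:R * (c * 2 ^+ L))).
  apply: ler_sum => B _.
  have term0 (Q : {set 'I_m}) : 0 <= (bad B Q)%:R * (c * 2 ^+ L) by rewrite mulr_ge0.
  have [/hasP[Q Qs bQ]|/hasPn good] := boolP (has (bad B) sets).
    rewrite (big_rem Q) // bQ mul1r -[leLHS]addr0 lerD ?sumr_ge0 //.
    by rewrite lerBlDr ler_wpDr ?value_ge0 ?hidden_shade_le.
  have same : alloc_rule M (report v i (hidden_shade L b0 c0 A B)) w' = (run tr v0).1.
    rewrite /alloc_rule -/tr (@run_agree _ _ _ tr v0) // => j Q jQ.
    have [->|ji] := eqVneq j i; last by rewrite /v0 !report_other.
    rewrite /v0 !report_same hidden_shade_balanced //; apply/negPn/good.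
    by rewrite inE; apply/orP; right; apply/mapP; exists (j, Q).
  rewrite same hidden_shade_balanced ?subrr ?sumr_ge0 //.
  by apply/negPn/good; rewrite mem_head.
rewrite exchange_big /=.
apply: (@le_trans _ _ (\sum_(Q <- sets) (4 * 2 ^+ m / 4 ^+ t) * (c * 2 ^+ L))).
  apply: ler_sum => Q _; rewrite -mulr_suml ler_wpM2r //.
  rewrite ler_pdivlMr ?exprn_gt0 //.
  have := @unbalanced_count R m w t (Q :&: A) w0 _.
  move=> /(_ _) h; apply: le_trans (h _); last first.
    apply: leq_trans m_le; rewrite -[X in (_ <= X)%N](card_ord m); exact: max_card.
  rewrite ler_wpM2r ?exprn_ge0 // -natr_sum ler_nat -sum1dep_card [leqRHS]big_mkcond /=.
  by apply: leq_sum => B _; rewrite /bad; case: (balanced _ _ _).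
rewrite big_const_seq count_predT iter_addr_0 /= size_map size_queries.
rewrite /hiding_error.
have sz : (num_queries tr v0).+1%:R <= q.+1%:R :> R by rewrite ler_nat ltnS; apply: few_queries.
set X := 4 * 2 ^+ m / 4 ^+ t * (c * 2 ^+ L).
have -> : 2 ^+ m * (c * (2 ^+ L * (q.+1%:R * (4 / 4 ^+ t)))) = q.+1%:R * X :> R.
  by rewrite /X; field; rewrite expf_neq0 // pnatr_eq0.
by rewrite -[leLHS]mulr_natl ler_wpM2r // /X mulr_ge0 // divr_ge0 ?mulr_ge0 ?exprn_ge0.
Qed.

Definition level_error : R := (16 * b)%:R + hiding_error.

Lemma level_error_ge0 : 0 <= level_error.
Proof. by apply: addr_ge0; [exact: ler0n | exact: hiding_error_ge0]. Qed.

(** Two deviations, averaged over [B]: from the hidden valuation to the scaled shade of [A :&: B],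
    and from the shade of [A] to the hidden valuation. Payments are equal under equal reports, so
    only values are compared. *)
Lemma chain_step v i (c c' : R) (c0 : 0 <= c) (c0' : 0 <= c') A :
  c' = 161 / 160 * c ->
  (1 - eps) ^+ 2 *
    (\sum_(B : {set 'I_m}) utility v i (shade L c0' (A :&: B)) (shade L c0' (A :&: B)))
  <= 2 ^+ m * (utility v i (shade L c0 A) (shade L c0 A) + c * level_error).
Proof.
move=> cE; set V := shade L c0 A.
have e1 : 0 <= 1 - eps by rewrite subr_ge0.
pose f B := hidden_shade L b0 c0 A B.
pose D B := mean_value M (f B) (report v i (f B)) i - mean_value M V (report v i (f B)) i.
have step B : (1 - eps) ^+ 2 * utility v i (shade L c0' (A :&: B)) (shade L c0' (A :&: B)) <=
    utility v i V V + (1 - eps) * D B + c * (16 * b)%:R.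
  set g := shade L c0' (A :&: B).
  have h1 := utility_truthful v i (f B) g.
  have h2 := utility_truthful v i V (f B).
  have h3 : utility v i g g - c * (16 * b)%:R <= utility v i (f B) g.
    rewrite /utility addrAC lerD2r lerBlDr.
    have -> : c * (16 * b)%:R = mean_alloc M (report v i g) (fun=> c * (16 * b)%:R).
      by rewrite mean_alloc_cst.
    rewrite -lerBlDr -mean_allocB; apply: mean_alloc_le => S.
    exact: hidden_shade_ge.
  have h4 : utility v i V (f B) = utility v i (f B) (f B) - D B.
    by rewrite /utility /D; lra.
  have h5 : (1 - eps) * ((1 - eps) * utility v i (f B) g) <=
      (1 - eps) * utility v i (f B) (f B) by rewrite ler_wpM2l.
  have h6 : (1 - eps) ^+ 2 * (utility v i g g - c * (16 * b)%:R) <=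
      (1 - eps) ^+ 2 * utility v i (f B) g by rewrite ler_wpM2l // exprn_ge0.
  have h7 : (1 - eps) ^+ 2 * (c * (16 * b)%:R) <= c * (16 * b)%:R.
    by rewrite ler_piMl ?mulr_ge0 // exprn_ile1 // gerBl.
  have arith (e u1 u2 u3 u4 d k : R) : e * (u3 - d) <= u4 -> e * (e * u2) <= e * u3 ->
      e ^+ 2 * (u1 - k) <= e ^+ 2 * u2 -> e ^+ 2 * k <= k ->
      e ^+ 2 * u1 <= u4 + e * d + k.
    by rewrite !expr2 !mulrBr mulrA => *; lra.
  by apply: (arith _ _ _ _ _ _ _ _ h5 h6 h7); rewrite -h4.
rewrite mulr_sumr; apply: (le_trans (ler_sum _ (fun B _ => step B))).
rewrite 2!big_split /= -mulr_sumr !sum_sets_const.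
have hD : (1 - eps) * \sum_(B : {set 'I_m}) D B <= 2 ^+ m * (c * hiding_error).
  apply: (@le_trans _ _ ((1 - eps) * (2 ^+ m * (c * hiding_error)))).
    by rewrite ler_wpM2l //; apply: hidden_close.
  rewrite ler_piMl ?gerBl // !mulr_ge0 ?exprn_ge0 // hiding_error_ge0 //.
rewrite -addrA [in leRHS]mulrDr lerD2l addrC /level_error [c * (_ + _)]mulrDr.
by rewrite [2 ^+ m * (_ + _)]mulrDr lerD2l.
Qed.

(** Nested pairs let a sum over [j.+1] flips split off one random subset, as the induction in
    [chain] requires. *)
Fixpoint flips (j : nat) : finType :=
  if j is j'.+1 then ({set 'I_m} * flips j')%type : finType else unit.

(* The core of independent uniform flips contains each item with probability [2^-j]. *)
Fixpoint core (j : nat) : flips j -> {set 'I_m} :=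
  match j with
  | 0 => fun=> [set: 'I_m]%SET
  | j'.+1 => fun x => x.1 :&: core x.2
  end.

Lemma sum_flips (V : nmodType) j (F : flips j.+1 -> V) :
  \sum_x F x = \sum_(B : {set 'I_m}) \sum_(y : flips j) F (B, y).
Proof. by rewrite pair_big /=; apply: eq_bigr => -[]. Qed.

Lemma card_flips j : #|flips j| = ((2 ^ m) ^ j)%N.
Proof.
elim: j => [|j IH] /=; first by rewrite card_unit.
by rewrite card_prod card_sets IH expnS.
Qed.

(** Accumulates the errors of the levels: each further level scales the valuation by 161/160 and
    pays two factors [1 - eps]. *)
Definition growth_sum (j : nat) : R :=
  \sum_(k < j) ((1 - eps) ^+ 2 * (161 / 160)) ^+ k.

Lemma growth_sum_ge0 j : 0 <= growth_sum j.
Proof.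
apply: sumr_ge0 => k _; apply: exprn_ge0; apply: mulr_ge0; first exact: sqr_ge0.
lra.
Qed.

Lemma growth_sumS j :
  growth_sum j.+1 = 1 + (1 - eps) ^+ 2 * (161 / 160) * growth_sum j.
Proof.
rewrite /growth_sum big_ord_recl expr0 mulr_sumr; congr (_ + _).
by apply: eq_bigr => k _; rewrite lift0 -[RHS]exprS.
Qed.

(** Induction from the top: the first flip replaces [A] by [A :&: B] and [c] by [161/160 c], hence
    the generality in both. *)
Lemma chain v i j (c c' : R) (c0 : 0 <= c) (c0' : 0 <= c') A :
  c' = (161 / 160) ^+ j * c ->
  ((1 - eps) ^+ 2) ^+ j *
    (\sum_(x : flips j) utility v i (shade L c0' (A :&: core x)) (shade L c0' (A :&: core x)))
  <= #|flips j|%:R *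
     (utility v i (shade L c0 A) (shade L c0 A) + c * level_error * growth_sum j).
Proof.
elim: j c c0 A => [|j IH] c c0 A cE.
  rewrite expr0 mul1r in cE; subst c'.
  rewrite expr0 mul1r card_unit mul1r /growth_sum big_ord0 mulr0 addr0.
  rewrite (big_pred1 tt) /=; last by case.
  by rewrite finset.setIT (_ : c0' = c0) //; apply: Prop_irrelevance.
have c0'' : 0 <= 161 / 160 * c by rewrite mulr_ge0 // divr_ge0.
rewrite sum_flips mulr_sumr.
have cE' : c' = (161 / 160) ^+ j * (161 / 160 * c) by rewrite cE exprSr -[LHS]mulrA.
pose s : R := (1 - eps) ^+ 2.
have s0 : 0 <= s by rewrite sqr_ge0.
apply: (@le_trans _ _ (\sum_(B : {set 'I_m}) s * (#|flips j|%:R *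
   (utility v i (shade L c0'' (A :&: B)) (shade L c0'' (A :&: B)) +
    161 / 160 * c * level_error * growth_sum j)))).
  apply: ler_sum => B _; rewrite exprS -/s -mulrA ler_wpM2l //.
  apply: le_trans (IH _ c0'' (A :&: B) cE').
  rewrite ler_wpM2l ?exprn_ge0 ?subr_ge0 //; apply: ler_sum => y _.
  by rewrite -finset.setIA.
under eq_bigr do rewrite mulrCA mulrDr.
rewrite -mulr_sumr big_split /= sum_sets_const -mulr_sumr.
have -> : #|flips j.+1|%:R = #|flips j|%:R * 2 ^+ m :> R.
  by rewrite !card_flips expnS natrM mulrC (natrX _ 2 m).
rewrite -[leRHS]mulrA ler_wpM2l // growth_sumS -/s.
have arith (S p U E G : R) : s * S <= p * (U + c * E) ->
  s * S + p * (s * (161 / 160 * c * E * G)) <= p * (U + c * E * (1 + s * (161 / 160) * G)).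
  by move=> h; lra.
exact/arith/chain_step.
Qed.

(** The bottom valuation is half the end of the chain. A player with twice that valuation who
    reports it gets twice the value minus the payment, hence at least the value, by individual
    rationality; this turns utilities into values. *)
Lemma top_beats_bottom v i j (c' : R) (top0 : 0 <= 1 :> R) (c0' : 0 <= c') :
  c' = (161 / 160) ^+ j / 2 ->
  (1 - eps) * ((1 - eps) ^+ 2) ^+ j *
    (\sum_(x : flips j) mean_value M (shade L c0' (core x)) (report v i (shade L c0' (core x))) i)
  <= #|flips j|%:R *
     (mean_value M (shade L top0 [set: 'I_m]%SET) (report v i (shade L top0 [set: 'I_m]%SET)) i
       + level_error * growth_sum j).
Proof.
move=> cE; have c0 : 0 <= (161 / 160) ^+ j :> R by rewrite exprn_ge0 // divr_ge0.
have e1 : 0 <= 1 - eps by rewrite subr_ge0.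
have := @chain v i j 1 _ top0 c0 [set: 'I_m]%SET; rewrite mulr1 => /(_ erefl).
rewrite mul1r => h; apply: (le_trans _ (le_trans h _)); last first.
  by rewrite ler_wpM2l // lerD2r utility_le.
rewrite mulrAC mulrC ler_wpM2l ?exprn_ge0 //.
rewrite mulr_sumr; apply: ler_sum => x _; rewrite finset.setTI.
apply: le_trans (utility_truthful v i _ (shade L c0' (core x))).
rewrite ler_wpM2l //.
have := utility_ge0 v i (shade L c0' (core x)); rewrite /utility.
have -> : mean_value M (shade L c0 (core x)) (report v i (shade L c0' (core x))) i =
    2 * mean_value M (shade L c0' (core x)) (report v i (shade L c0' (core x))) i.
  rewrite /mean_value -mean_allocZ; congr mean_alloc; apply/funext => S.
  by rewrite !shadeE cE; field.
lra.
Qed.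

End Chain.

(** * Random profiles *)

Section Resampling.
Variables (R : realType) (I T : finType).
Implicit Types (g : {ffun I -> T} -> R).

Definition resample (x : {ffun I -> T}) (i : I) (y : T) : {ffun I -> T} :=
  [ffun k => if k == i then y else x k].

(** Exchanging [y] with the coordinate [i] of [x] is an involution on pairs. *)
Lemma sum_resample i g : \sum_x \sum_y g (resample x i y) = #|T|%:R * \sum_x g x.
Proof.
pose h (p : {ffun I -> T} * T) := (resample p.1 i p.2, p.1 i).
have hK : involutive h.
  case=> x y; rewrite /h /= /resample ffunE eqxx; congr pair.
  by apply/ffunP => k; rewrite !ffunE; case: eqP => // ->.
rewrite pair_big /= (reindex_inj (inv_inj hK)) /=.
rewrite (eq_bigr (fun p => g p.1)); last first.
  by move=> p _; congr g; exact: (congr1 fst (hK p)).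
rewrite -(pair_big xpredT xpredT (fun x _ => g x)) /= mulr_sumr.
by apply: eq_bigr => x _; rewrite sumr_const mulr_natl.
Qed.

Lemma sum_coord i (h : T -> R) :
  #|T|%:R * (\sum_(x : {ffun I -> T}) h (x i)) = #|{ffun I -> T}|%:R * \sum_y h y.
Proof.
rewrite -(sum_resample i (fun x : {ffun I -> T} => h (x i))) mulr_natl -sumr_const.
by apply: eq_bigr => x _; apply: eq_bigr => y _; rewrite ffunE eqxx.
Qed.

Lemma sum_coord2 i k (h : T -> T -> R) : k != i ->
  #|T|%:R ^+ 2 * (\sum_(x : {ffun I -> T}) h (x i) (x k)) =
  #|{ffun I -> T}|%:R * \sum_y \sum_z h y z.
Proof.
move=> ki; rewrite expr2 -mulrA -(sum_resample i (fun x : {ffun I -> T} => h (x i) (x k))).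
rewrite (eq_bigr (fun x : {ffun I -> T} => \sum_y h y (x k))); last first.
  by move=> x _; apply: eq_bigr => y _; rewrite !ffunE eqxx (negbTE ki).
rewrite exchange_big mulr_sumr mulr_sumr; apply: eq_bigr => y _.
by rewrite (sum_coord k).
Qed.

End Resampling.

(** * Moments of the sizes of random cores *)

Section Coverage.
Variables (R : realType) (m : nat).

(** This is [sum_tilt] at weights 1 and 0, where [0 ^+ #|S :\: B|] is the indicator of
    [S \subset B]. *)
Lemma sum_superset (S : {set 'I_m}) :
  \sum_(B : {set 'I_m}) (S \subset B)%:R * 2 ^+ #|S| = 2 ^+ m :> R.
Proof.
have Sm : (#|S| <= m)%N by rewrite -[X in (_ <= X)%N](card_ord m); apply: max_card.
have := sum_tilt S (1 : R) 0; rewrite addr0 expr1n mul1r => E.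
rewrite -mulr_suml (eq_bigr (fun B => 1 ^+ #|S :&: B| * 0 ^+ #|S :\: B|)).
  by rewrite E -exprD subnK.
by move=> B _; rewrite expr1n mul1r expr0n cards_eq0 finset.setD_eq0.
Qed.

Lemma sum_core_superset j (S : {set 'I_m}) :
  \sum_(x : flips m j) (S \subset core x)%:R * (2 ^+ #|S|) ^+ j = #|flips m j|%:R :> R.
Proof.
elim: j => [|j IH].
  rewrite expr0 (big_pred1 tt) /=; last by case.
  by rewrite finset.subsetT mulr1 card_unit.
rewrite sum_flips.
rewrite (eq_bigr (fun B : {set 'I_m} => (S \subset B)%:R * 2 ^+ #|S| * #|flips m j|%:R)).
  rewrite -mulr_suml sum_superset !card_flips expnS natrM; congr (_ * _).
  by rewrite natrX.
move=> B _; rewrite -IH mulr_sumr; apply: eq_bigr => y _.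
have -> : (S \subset core ((B, y) : flips m j.+1)) = (S \subset B) && (S \subset core y).
  exact: finset.subsetI.
by rewrite -mulnb natrM exprS; ring.
Qed.

Lemma card_sum (A : {set 'I_m}) : #|A|%:R = \sum_u (u \in A)%:R :> R.
Proof. by rewrite -natr_sum -sum1_card big_mkcond. Qed.

Lemma sum_mem_core j u :
  \sum_(x : flips m j) (u \in core x)%:R = #|flips m j|%:R / 2 ^+ j :> R.
Proof.
rewrite -(sum_core_superset j [set u]) -mulr_suml cards1 expr1.
rewrite mulfK ?expf_neq0 ?pnatr_eq0 //.
by apply: eq_bigr => x _; rewrite finset.sub1set.
Qed.

Lemma sum_card_core j :
  \sum_(x : flips m j) #|core x|%:R = #|flips m j|%:R * (m%:R / 2 ^+ j) :> R.
Proof.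
under eq_bigr do rewrite card_sum.
rewrite exchange_big /=; under eq_bigr do rewrite sum_mem_core.
by rewrite sumr_const card_ord -[LHS]mulr_natl mulrCA.
Qed.

(** Two distinct items both lie in the core with probability [4^-j], a single item with probability
    [2^-j]. *)
Lemma sum_card_core_sqr j :
  \sum_(x : flips m j) #|core x|%:R ^+ 2 <=
  #|flips m j|%:R * (m%:R / 2 ^+ j + (m%:R / 2 ^+ j) ^+ 2) :> R.
Proof.
have p2 : 2 ^+ j != 0 :> R by rewrite expf_neq0 // pnatr_eq0.
apply: (@le_trans _ _ (\sum_(u < m) \sum_(v < m)
  #|flips m j|%:R * ((u == v)%:R / 2 ^+ j + (2 ^+ j)^-1 ^+ 2))); last first.
  under eq_bigr do rewrite -mulr_sumr big_split /= -mulr_suml sumr_const card_ord.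
  rewrite -mulr_sumr ler_wpM2l // big_split /= sumr_const card_ord.
  rewrite (eq_bigr (fun=> (2 ^+ j)^-1)); last first.
    move=> u _; rewrite (bigD1 u) //= eqxx big1 ?addr0 ?mul1r // => v /negbTE.
    by rewrite eq_sym => ->.
  rewrite sumr_const card_ord lerD //; first by rewrite -[leLHS]mulr_natl.
  rewrite -mulrnA -[leLHS]mulr_natl natrM expr2.
  by rewrite le_eqVlt; apply/orP; left; apply/eqP; field.
rewrite (eq_bigr (fun x : flips m j =>
   \sum_(u < m) \sum_(v < m) ([set u; v]%SET \subset core x)%:R)); last first.
  move=> x _; rewrite expr2 {1}card_sum mulr_suml; apply: eq_bigr => u _.
  rewrite card_sum mulr_sumr; apply: eq_bigr => v _.
  by rewrite finset.subUset !finset.sub1set -mulnb natrM.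
rewrite exchange_big /=; apply: ler_sum => u _.
rewrite exchange_big /=; apply: ler_sum => v _.
have := sum_core_superset j [set u; v]%SET; rewrite -mulr_suml.
set X := \sum_(_ | _) _ => XE.
rewrite -XE cards2; case: eqP => [uv|uv] /=.
  rewrite expr1 -mulrA ler_peMr ?sumr_ge0 //.
  by rewrite mulrDr mul1r divff // lerDl mulr_ge0 // ?exprn_ge0 ?sqr_ge0.
have E : (2 ^+ 2) ^+ j * (2 ^+ j)^-1 ^+ 2 = 1 :> R by rewrite exprAC -exprMn divff // expr1n.
by rewrite mul0r add0r -[leRHS]mulrA E mulr1.
Qed.

Lemma sum_card_core_meet j :
  \sum_(x : flips m j) \sum_(y : flips m j) #|core x :&: core y|%:R =
  #|flips m j|%:R ^+ 2 * (m%:R / (2 ^+ j) ^+ 2) :> R.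
Proof.
transitivity (\sum_(u < m) \sum_(x : flips m j) \sum_(y : flips m j)
   (u \in core x)%:R * (u \in core y)%:R : R).
  rewrite [RHS]exchange_big; apply: eq_bigr => x _.
  rewrite [RHS]exchange_big; apply: eq_bigr => y _.
  by rewrite card_sum; apply: eq_bigr => u _; rewrite finset.inE -mulnb natrM.
rewrite (eq_bigr (fun=> (#|flips m j|%:R / 2 ^+ j) ^+ 2)).
  rewrite sumr_const card_ord -[LHS]mulr_natl expr_div_n; ring.
move=> u _; under eq_bigr do rewrite -mulr_sumr sum_mem_core.
by rewrite -mulr_suml sum_mem_core expr2.
Qed.

End Coverage.

(** * Welfare of disjoint bundles *)

Section Welfare.
Variables (R : realType) (n m : nat).

Lemma welfare_le_max (v : profile R n m) S : feasible S -> welfare v S <= max_welfare v.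
Proof. by move=> fS; rewrite /max_welfare; apply: (@le_bigmax_cond _ _ _ _ S). Qed.

Lemma card_feasible (S : allocation n m) : feasible S -> (\sum_(i < n) #|S i| <= m)%N.
Proof.
move=> /forallP fS.
rewrite (eq_bigr (fun i => \sum_(u < m) (u \in S i))%N); last first.
  by move=> i _; rewrite -sum1_card big_mkcond; apply: eq_bigr => u _; case: ifP.
rewrite exchange_big /= -[X in (_ <= X)%N](card_ord m) -sum1_card; apply: leq_sum => u _.
have [i ui|none] := pickP (fun i => u \in S i); last first.
  by rewrite big1 // => i _; rewrite none.
rewrite (bigD1 i) //= ui big1 ?addn0 // => k ki.
have /forallP/(_ k)/implyP := fS i; rewrite eq_sym => /(_ ki) /disjointFr -> //.
Qed.

Lemma sum_phi_feasible L K (S : allocation n m) (P : pred 'I_n) : (0 < K)%N -> feasible S ->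
  \sum_(i < n | P i) phi R L #|S i| <= phi R L K * (n%:R + m%:R / K%:R).
Proof.
move=> K0 fS; have K0' : 0 < K%:R :> R by rewrite ltr0n.
apply: (@le_trans _ _ (\sum_(i < n) phi R L #|S i|)).
  by rewrite [leRHS](bigID P) /= lerDl sumr_ge0 // => i _; apply: phi_ge0.
apply: (@le_trans _ _ (\sum_(i < n) phi R L K * (1 + #|S i|%:R / K%:R))).
  by apply: ler_sum => i _; apply: phi_upper.
rewrite -mulr_sumr ler_wpM2l ?phi_ge0 // big_split /= sumr_const card_ord.
rewrite lerD2l -mulr_suml ler_pM2r ?invr_gt0 // -natr_sum ler_nat.
exact: card_feasible.
Qed.

End Welfare.

(** * The random profile and its average optimum *)

Section RandomProfiles.
Variables (R : realType) (n m L j : nat) (c : R) (top0 : 0 <= 1 :> R) (c0 : 0 <= c).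

(** The boolean is true for a top player, who values all items, and false for a bottom player, who
    values a core. Flips are drawn in both cases, so kind and core are independent and the kinds
    equally likely. *)
Definition ptype : finType := (bool * flips m j)%type.

Definition type_valuation (y : ptype) : valuation R m :=
  if y.1 then shade L top0 [set: 'I_m]%SET else shade L c0 (core y.2).

Definition random_profile (x : {ffun 'I_n -> ptype}) : profile R n m :=
  fun i => type_valuation (x i).

Lemma random_profile_resample x i y :
  random_profile (resample x i y) = report (random_profile x) i (type_valuation y).
Proof.
by apply/funext => k; rewrite /random_profile /report /= ffunE; case: (k == i).
Qed.

Lemma sum_ptype (V : nmodType) (F : ptype -> V) :
  \sum_y F y = \sum_(z : flips m j) F (true, z) + \sum_(z : flips m j) F (false, z).
Proof.
rewrite -(big_bool _ (fun b => \sum_(z : flips m j) F (b, z))) /= pair_big /=.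
by apply: eq_bigr => -[].
Qed.

Lemma card_ptype : #|ptype| = (2 * #|flips m j|)%N.
Proof. by rewrite card_prod card_bool. Qed.

Lemma flips_gt0 : 0 < #|flips m j|%:R :> R.
Proof. by rewrite ltr0n card_flips !expn_gt0. Qed.

Variables (K n0 : nat).
Hypothesis K0 : (0 < K)%N.
Hypothesis mE : m = (K * 2 ^ j)%N.
Hypothesis n0_le : (n0 <= n)%N.
Hypothesis n0_small : (4 * n0 <= 2 ^ j)%N.

(** Serving only [n0 <= 2^j / 4] players keeps the average overlap of a core a small fraction of its
    size. Cores are removed whatever the kind of their owner, so the overlap depends on the cores
    alone. *)
Definition private_part (x : {ffun 'I_n -> ptype}) : allocation n m :=
  [ffun i : 'I_n => if (i < n0)%N && ~~ (x i).1 then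
     core (x i).2 :\: \bigcup_(k < n | (k < n0)%N && (k != i)) core (x k).2
   else finset.set0].

Lemma private_part_feasible x : feasible (private_part x).
Proof.
apply/forallP => i; apply/forallP => k; apply/implyP => ik.
rewrite -finset.setI_eq0; apply/eqP/finset.setP => u.
rewrite finset.in_setI finset.in_set0 !ffunE.
case: ifP => [/andP[i0 _]|_]; last by rewrite finset.in_set0.
case: ifP => [/andP[k0 _]|_]; last by rewrite finset.in_set0 andbF.
rewrite !finset.in_setD; apply/negP => /andP[/andP[/finset.bigcupP h _] /andP[_ uk]].
by apply: h; exists k => //; rewrite k0 eq_sym.
Qed.

Definition overlap (x : {ffun 'I_n -> ptype}) (i : 'I_n) : R :=
  \sum_(k < n | (k < n0)%N && (k != i)) #|core (x i).2 :&: core (x k).2|%:R.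

Lemma card_private_part (x : {ffun 'I_n -> ptype}) (i : 'I_n) :
  #|core (x i).2|%:R - overlap x i <=
  #|core (x i).2 :\: \bigcup_(k < n | (k < n0)%N && (k != i)) core (x k).2|%:R :> R.
Proof.
rewrite lerBlDr -(cardsID (\bigcup_(k < n | (k < n0)%N && (k != i)) core (x k).2)) natrD.
rewrite addrC lerD2l /overlap -natr_sum ler_nat.
rewrite big_distrr /=.
elim/big_ind2: _ => [|a A b B hA hB|k _] //; first by rewrite cards0.
by apply: (leq_trans (leq_card_setU A B)); apply: leq_add.
Qed.

(** Apply [phi_lower] to the private part: the overlap enters the linear term by a union bound, and
    the whole core bounds the quadratic one. *)
Lemma max_welfare_random_profile (x : {ffun 'I_n -> ptype}) :
  \sum_(i < n | (i < n0)%N) c * phi R L K * ((~~ (x i).1)%:R *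
    (#|core (x i).2|%:R / K%:R - overlap x i / K%:R - #|core (x i).2|%:R ^+ 2 / (4 * K%:R ^+ 2)))
  <= max_welfare (random_profile x).
Proof.
apply: le_trans (welfare_le_max _ (private_part_feasible x)).
have K0' : 0 < K%:R :> R by rewrite ltr0n.
rewrite /welfare [leRHS](bigID (fun i : 'I_n => (i < n0)%N)) /= -[leLHS]addr0.
apply: lerD; last by apply: sumr_ge0 => i _; apply: value_ge0.
apply: ler_sum => i i0; rewrite /private_part ffunE i0 /=.
rewrite /random_profile /type_valuation.
case: (x i).1; first by rewrite mul0r mulr0; apply: value_ge0.
rewrite mul1r shadeE -mulrA ler_wpM2l //.
set T := core _; set U := \bigcup_(_ < _ | _) _.
have -> : (T :\: U) :&: T = T :\: U.
  by apply/finset.setIidPl; apply: finset.subsetDl.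
apply: le_trans (phi_lower R L _ K0); rewrite ler_wpM2l ?phi_ge0 //.
apply: lerB.
  by rewrite -mulrBl ler_pM2r ?invr_gt0 //; apply: card_private_part.
have -> : #|T|%:R ^+ 2 / (4 * K%:R ^+ 2) = (#|T|%:R / K%:R) ^+ 2 / 4 :> R.
  by field; rewrite gt_eqF.
rewrite ler_pM2r ?invr_gt0 // lerXn2r ?nnegrE ?divr_ge0 //.
rewrite ler_pM2r ?invr_gt0 // ler_nat subset_leq_card //; apply: finset.subsetDl.
Qed.

Let nprof : R := #|{ffun 'I_n -> ptype}|%:R.

Let ptype_gt0 : 0 < #|ptype|%:R :> R.
Proof. by rewrite card_ptype natrM mulr_gt0 // flips_gt0. Qed.

Lemma sum_bottom (i : 'I_n) (h : flips m j -> R) :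
  \sum_(x : {ffun 'I_n -> ptype}) (~~ (x i).1)%:R * h (x i).2 =
  nprof / (2 * #|flips m j|%:R) * \sum_z h z.
Proof.
have := sum_coord i (fun y : ptype => (~~ y.1)%:R * h y.2).
rewrite sum_ptype /= [X in _ * (X + _)]big1; last by move=> z _; rewrite mul0r.
rewrite add0r; under [X in _ = _ * X]eq_bigr do rewrite mul1r.
rewrite card_ptype natrM -/nprof => E.
have f0 := flips_gt0.
apply: (mulfI (lt0r_neq0 (mulr_gt0 (ltr0Sn R 1) f0))); rewrite E.
by field; rewrite gt_eqF.
Qed.

Lemma sum_bottom2 (i k : 'I_n) (h : flips m j -> flips m j -> R) : k != i ->
  \sum_(x : {ffun 'I_n -> ptype}) (~~ (x i).1)%:R * h (x i).2 (x k).2 =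
  nprof / (2 * #|flips m j|%:R ^+ 2) * \sum_y \sum_z h y z.
Proof.
move=> ki; have := sum_coord2 (fun y y' : ptype => (~~ y.1)%:R * h y.2 y'.2) ki.
rewrite sum_ptype /= [X in _ * (X + _)]big1; last first.
  by move=> z _; rewrite big1 // => y _; rewrite mul0r.
rewrite add0r (eq_bigr (fun z => 2 * \sum_y h z y)); last first.
  move=> z _; rewrite sum_ptype /=.
  by under eq_bigr do rewrite mul1r; rewrite -mulr2n mulr_natl.
rewrite -mulr_sumr card_ptype natrM -/nprof => E.
have f0 := flips_gt0.
have nz : (2 * #|flips m j|%:R) ^+ 2 != 0 :> R.
  by rewrite expf_neq0 // gt_eqF // mulr_gt0.
apply: (mulfI nz); rewrite E.
by field; rewrite gt_eqF.
Qed.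

(** In units of [c phi(K)] each of the [n0] players contributes on average at least
    [1/2 - 1/8 - 1/4 = 1/8]. The terms come from the mean core size [K], a mean overlap of at most
    [K / 4] and a second moment of at most [2 K^2], each halved by the choice of the kind. *)
Lemma sum_max_welfare :
  nprof * (c * phi R L K * (n0%:R / 8)) <=
  \sum_(x : {ffun 'I_n -> ptype}) max_welfare (random_profile x).
Proof.
apply: le_trans (ler_sum _ (fun x _ => max_welfare_random_profile x)).
have K0' : 0 < K%:R :> R by rewrite ltr0n.
have f0 := flips_gt0.
have p0 : 0 < 2 ^+ j :> R by rewrite exprn_gt0.
have mK : m%:R / 2 ^+ j = K%:R :> R.
  by rewrite {1}mE natrM natrX mulfK // gt_eqF.
rewrite exchange_big /=.
have -> : nprof * (c * phi R L K * (n0%:R / 8)) =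
    \sum_(i < n | (i < n0)%N) c * phi R L K * (nprof / 8).
  rewrite (big_ord_narrow n0_le) /= sumr_const card_ord -[RHS]mulr_natl; ring.
apply: ler_sum => i i0; rewrite -mulr_sumr ler_wpM2l ?mulr_ge0 ?phi_ge0 //.
under eq_bigr do rewrite 2!mulrBr [_ * (_ / K%:R)]mulrA [_ * (overlap _ _ / _)]mulrA
  [_ * (_ / (4 * K%:R ^+ 2))]mulrA.
rewrite !sumrB -!mulr_suml (sum_bottom i (fun z => #|core z|%:R)).
rewrite (sum_bottom i (fun z => #|core z|%:R ^+ 2)).
rewrite sum_card_core mK.
have np0 : 0 <= nprof by rewrite ler0n.
have A2 : \sum_(x : {ffun 'I_n -> ptype}) (~~ (x i).1)%:R * overlap x i <= nprof * K%:R / 8.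
  rewrite /overlap; under eq_bigr do rewrite mulr_sumr.
  rewrite exchange_big /=.
  rewrite (eq_bigr (fun=> nprof * K%:R / (2 * 2 ^+ j))); last first.
    move=> k /andP[_ ki].
    rewrite (sum_bottom2 (fun y z => #|core y :&: core z|%:R) ki) sum_card_core_meet -mK.
    by field; rewrite !gt_eqF.
  apply: (@le_trans _ _ (\sum_(k < n | (k < n0)%N) nprof * K%:R / (2 * 2 ^+ j))).
    rewrite [leRHS](bigID (fun k => k != i)) /= lerDl; apply: sumr_ge0 => k _.
    by rewrite divr_ge0 ?mulr_ge0 // ltW.
  rewrite (big_ord_narrow n0_le) /= sumr_const card_ord -[leLHS]mulr_natl.
  have : 4 * n0%:R <= 2 ^+ j :> R by rewrite -natrX -natrM ler_nat.
  have -> : n0%:R * (nprof * K%:R / (2 * 2 ^+ j)) = 4 * n0%:R / 2 ^+ j * (nprof * K%:R / 8) :> R.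
    by field; rewrite gt_eqF.
  move=> h; rewrite ler_piMl ?divr_ge0 ?mulr_ge0 // ler_pdivrMr // mul1r //.
have A3 : nprof / (2 * #|flips m j|%:R) * \sum_(z : flips m j) #|core z|%:R ^+ 2 <=
    nprof * K%:R ^+ 2.
  have := sum_card_core_sqr R m j; rewrite mK => h.
  have nf : 0 <= nprof / (2 * #|flips m j|%:R) by rewrite divr_ge0 // mulr_ge0 // ltW.
  apply: (le_trans (ler_wpM2l nf h)).
  have -> : nprof / (2 * #|flips m j|%:R) * (#|flips m j|%:R * (K%:R + K%:R ^+ 2)) =
    nprof * ((K%:R + K%:R ^+ 2) / 2) by field; rewrite gt_eqF.
  rewrite ler_wpM2l //.
  have : 1 <= K%:R :> R by rewrite ler1n.
  rewrite expr2; nra.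
apply: (@le_trans _ _ (nprof / 2 - nprof / 8 - nprof / 4)); first by lra.
apply: lerB; [apply: lerB|].
- by rewrite le_eqVlt; apply/orP; left; apply/eqP; field; rewrite !gt_eqF.
- by rewrite ler_pdivrMr // mulrAC.
rewrite ler_pdivrMr ?mulr_gt0 ?exprn_gt0 //; apply: (le_trans A3).
by rewrite le_eqVlt; apply/orP; left; apply/eqP; field.
Qed.

End RandomProfiles.

(** * Averaging truthfulness and approximation over the profiles *)

Section Averaging.
Variables (R : realType) (n m : nat) (M : mechanism R n m) (eps : R) (q : nat).
Hypothesis eps0 : 0 <= eps.
Hypothesis eps1 : eps < 1.
Hypothesis rational : individually_rational M.
Hypothesis payments : nonneg_payments M.
Hypothesis truthful : approx_truthful M eps.
Hypothesis few_queries : queries_at_most M q.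
Variables (L w t j K n0 : nat).
Hypothesis w0 : (0 < w)%N.
Hypothesis t0 : (0 < t)%N.
Hypothesis m_le : (m <= w * w)%N.
Hypothesis L0 : (0 < L)%N.
Hypothesis m_lt : (m < 2 ^ L.-1)%N.
Hypothesis K0 : (0 < K)%N.
Hypothesis mE : m = (K * 2 ^ j)%N.
Hypothesis n0_le : (n0 <= n)%N.
Hypothesis n0_small : (4 * n0 <= 2 ^ j)%N.
Variables (c' : R) (top0 : 0 <= 1 :> R) (c0' : 0 <= c').
Hypothesis cE : c' = (161 / 160) ^+ j / 2.

Let profiles := {ffun 'I_n -> ptype m j}.
Let prof (x : profiles) : profile R n m := random_profile L top0 c0' x.
Let W x i : R := mean_value M (prof x i) (prof x) i.
Let a : R := (1 - eps) * ((1 - eps) ^+ 2) ^+ j.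
Let err : R := level_error R q L w t * growth_sum eps j.
Let nprof : R := #|{: profiles}|%:R.

(** Resampling player [i] makes both kinds equally likely with the other reports fixed, which is the
    setting of [top_beats_bottom]. *)
Lemma bottom_le_top (i : 'I_n) :
  a * (\sum_(x : profiles) (~~ (x i).1)%:R * W x i) <= \sum_(x : profiles) ((x i).1)%:R * (W x i + err).
Proof.
have T0 : 0 < #|ptype m j|%:R :> R.
  by rewrite card_ptype natrM mulr_gt0 // flips_gt0.
rewrite -(ler_pM2l T0) mulrCA.
rewrite -(sum_resample i (fun x : profiles => (~~ (x i).1)%:R * W x i)).
rewrite -(sum_resample i (fun x : profiles => ((x i).1)%:R * (W x i + err))).
rewrite mulr_sumr; apply: ler_sum => x _.
rewrite !sum_ptype /= [X in _ * (X + _)]big1; last first.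
  by move=> z _; rewrite ffunE eqxx mul0r.
rewrite [X in _ <= _ + X]big1; last by move=> z _; rewrite ffunE eqxx mul0r.
rewrite add0r addr0.
have WE y : W (resample x i y) i =
    mean_value M (type_valuation L top0 c0' y) (report (prof x) i (type_valuation L top0 c0' y)) i.
  by rewrite /W /prof random_profile_resample report_same.
under eq_bigr do rewrite ffunE eqxx mul1r WE.
under [leRHS]eq_bigr do rewrite ffunE eqxx mul1r WE.
have := top_beats_bottom eps0 (ltW eps1) rational payments truthful
  few_queries w0 t0 m_le L0 m_lt (prof x) i top0 c0' cE.
move=> h; apply: (le_trans h).
rewrite [leRHS](eq_bigr (fun=> mean_value M (shade L top0 [set: 'I_m]%SET)
   (report (prof x) i (shade L top0 [set: 'I_m]%SET)) i + err)) //.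
by rewrite sumr_const -[leRHS]mulr_natl.
Qed.

Lemma top_welfare (x : profiles) :
  \sum_i ((x i).1)%:R * W x i <= phi R L K * (n%:R + 2 ^+ j).
Proof.
have -> : \sum_i ((x i).1)%:R * W x i =
    mean_alloc M (prof x) (fun S => \sum_(i | (x i).1) phi R L #|S i|).
  rewrite mean_alloc_sum [RHS]big_mkcond; apply: eq_bigr => i _.
  rewrite /W /prof /random_profile /type_valuation.
  case: (x i).1; last by rewrite mul0r.
  rewrite mul1r; congr mean_alloc; apply/funext => S.
  by rewrite shadeE mul1r finset.setIT.
(* A one-point family turns the coupling into a pointwise bound for a single profile. *)
have := @mean_alloc_coupling R n m M unit (fun=> prof x)
  (fun _ S => \sum_(i | (x i).1) phi R L #|S i|) (phi R L K * (n%:R + 2 ^+ j)).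
rewrite big_const card_unit /= addr0; apply => w'.
rewrite big_const card_unit /= addr0.
have -> : 2 ^+ j = m%:R / K%:R :> R.
  by rewrite mE natrM natrX mulrC mulKf // pnatr_eq0 -lt0n.
apply: sum_phi_feasible => //; exact: alloc_rule_feasible.
Qed.

(** Top players hold at most [phi(K) (n + 2^j)] in total, and [a] times the bottom share is at most
    the top share plus errors. Since [a <= 1], the top bound counts twice. *)
Lemma approximation_bound (c : R) : 0 <= c -> achieves_approximation M c ->
  a * c * (c' * phi R L K * (n0%:R / 8)) <= 2 * phi R L K * (n%:R + 2 ^+ j) + n%:R * err.
Proof.
move=> c0 approx.
have np0 : 0 < nprof.
  by rewrite ltr0n card_ffun expn_gt0 card_ptype muln_gt0 card_flips !expn_gt0.
have e1 : 0 <= 1 - eps by rewrite subr_ge0 ltW.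
have a0 : 0 <= a by rewrite mulr_ge0 // !exprn_ge0.
have a1 : a <= 1.
  by rewrite /a -exprM -exprS exprn_ile1 // gerBl.
have err0 : 0 <= err.
  by apply: mulr_ge0; [exact: level_error_ge0 | exact: growth_sum_ge0].
have h1 : c * (\sum_(x : profiles) max_welfare (prof x)) <= \sum_(x : profiles) \sum_i W x i.
  rewrite mulr_sumr; apply: ler_sum => x _.
  have := approx (prof x); rewrite (expectation_alloc M (prof x) (welfare (prof x))) lee_fin.
  by rewrite /welfare mean_alloc_sum.
have h2 := sum_max_welfare L top0 c0' K0 mE n0_le n0_small.
rewrite -/nprof in h2.
have split_sum : \sum_(x : profiles) \sum_i W x i =
    (\sum_(x : profiles) \sum_i ((x i).1)%:R * W x i) + \sum_i \sum_(x : profiles) (~~ (x i).1)%:R * W x i.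
  rewrite [X in _ + X]exchange_big -big_split /=; apply: eq_bigr => x _.
  rewrite -big_split /=; apply: eq_bigr => i _.
  by case: (x i).1; rewrite mul1r mul0r ?addr0 ?add0r.
have top : \sum_(x : profiles) \sum_i ((x i).1)%:R * W x i <= nprof * (phi R L K * (n%:R + 2 ^+ j)).
  rewrite /nprof mulr_natl -sumr_const; apply: ler_sum => x _; exact: top_welfare.
have bot : a * (\sum_i \sum_(x : profiles) (~~ (x i).1)%:R * W x i) <=
    nprof * (phi R L K * (n%:R + 2 ^+ j)) + nprof * (n%:R * err).
  rewrite mulr_sumr; apply: (le_trans (ler_sum _ (fun i _ => bottom_le_top i))).
  rewrite exchange_big /=.
  apply: (@le_trans _ _ (\sum_(x : profiles) (phi R L K * (n%:R + 2 ^+ j) + n%:R * err))); last first.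
    by rewrite sumr_const -[leLHS]mulr_natl mulrDr.
  apply: ler_sum => x _; under eq_bigr do rewrite mulrDr.
  rewrite big_split /=; apply: lerD; first exact: top_welfare.
  apply: (@le_trans _ _ (\sum_(i < n) err)).
    by apply: ler_sum => i _; case: (x i).1; rewrite ?mul1r ?mul0r.
  by rewrite sumr_const card_ord -[leLHS]mulr_natl.
have P0 : 0 <= phi R L K * (n%:R + 2 ^+ j) by rewrite mulr_ge0 ?phi_ge0 ?addr_ge0 ?exprn_ge0.
rewrite -(ler_pM2l np0).
apply: (@le_trans _ _ (a * (c * \sum_(x : profiles) max_welfare (prof x)))).
  have := ler_wpM2l (mulr_ge0 a0 c0) h2; lra.
apply: (le_trans (ler_wpM2l a0 h1)); rewrite split_sum mulrDr.
have top' : a * (\sum_(x : profiles) \sum_i ((x i).1)%:R * W x i) <= nprof * (phi R L K * (n%:R + 2 ^+ j)).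
  apply: (le_trans (ler_wpM2l a0 top)).
  by rewrite ler_piMl // mulr_ge0 // ltW.
apply: (le_trans (lerD top' bot)); lra.
Qed.

End Averaging.

(** * Choice of the parameters *)

Lemma poly_bound (p : {poly nat}) : exists C d : nat, forall n, (p.[n] <= C * n.+1 ^ d)%N.
Proof.
elim/poly_ind: p => [|p c [C [d IH]]].
  by exists 0%N, 0%N => n; rewrite horner0.
exists (C + c)%N, d.+1 => n; rewrite hornerMXaddC.
have h1 : (p.[n] * n <= C * n.+1 ^ d * n.+1)%N by apply: leq_mul.
have h2 : (c <= c * n.+1 ^ d.+1)%N by rewrite leq_pmulr // expn_gt0.
by rewrite mulnDl expnSr mulnA; apply: leq_add => //; rewrite -expnSr.
Qed.

(** With [u = n %/ k] one has [n.+1 <= k 2^u] and [C k^d <= u < 2^u], so the left side is at most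
    [2^(u (d + 1)) <= 2^n]. *)
Lemma exp2_dominates (C d : nat) : exists n0, forall n, (n0 <= n)%N -> (C * n.+1 ^ d <= 2 ^ n)%N.
Proof.
pose k := d.+1; exists (k * (C * k ^ d))%N => n hn.
pose u := (n %/ k)%N.
have hu : (C * k ^ d <= u)%N by rewrite leq_divRL // mulnC.
have h1 : (n.+1 <= k * 2 ^ u)%N.
  apply: (@leq_trans (k * u.+1)%N); first by rewrite mulnC ltn_ceil.
  by rewrite leq_mul2l ltn_expl ?orbT.
apply: (@leq_trans (2 ^ u * (2 ^ u) ^ d)%N).
  apply: (@leq_trans (C * (k * 2 ^ u) ^ d)%N).
    rewrite leq_mul2l; apply/orP; right.
    by case: (d) => // d'; rewrite leq_exp2r.
  rewrite expnMn mulnA leq_mul2r; apply/orP; right.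
  by apply: leq_trans hu _; rewrite ltnW // ltn_expl.
by rewrite -expnS -expnM leq_exp2l // leq_trunc_div.
Qed.

(** For [n = 2^J] the factor [16 n^10] is the [4 * 2^L] of [hiding_error] at [L = 10 J + 2]. *)
Lemma poly_bounded_exp2 q : poly_bounded q ->
  exists n0, forall n, (n0 <= n)%N -> (16 * n ^ 10 * (q n).+1 <= 2 ^ n)%N.
Proof.
case=> p hp; have [C [d hC]] := poly_bound p.
have [n0 h] := exp2_dominates (16 * C.+1) (10 + d); exists n0 => n /h; apply: leq_trans.
rewrite expnD mulnACA; apply: leq_mul.
  by rewrite leq_mul2l leq_exp2r // leqnSn orbT.
rewrite mulSn -addn1 addnC; apply: leq_add; first by rewrite expn_gt0.
exact: leq_trans (hp n) (hC n).
Qed.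

Lemma exp_unbounded (R : realType) (x C : R) : 1 < x ->
  exists J0, forall J, (J0 <= J)%N -> C <= x ^+ J.
Proof.
move=> x1; have d0 : 0 < x - 1 by rewrite subr_gt0.
exists (Num.bound (C / (x - 1))) => J hJ.
have h : C / (x - 1) <= J%:R.
  apply: (le_trans (ltW (unstable.ltr_bound _))).
  by rewrite ler_nat.
rewrite ler_pdivrMr // in h.
have := bernoulli J (ltW d0); have -> : 1 + (x - 1) = x by ring.
lra.
Qed.

(** Bernoulli gives [2 <= (1 + 1/k)^k]. In this form [n^gamma] compares directly with other [J]-th
    powers. *)
Lemma powR_2_pow_le (R : realType) k J : (0 < k)%N ->
  (2 ^ J)%:R `^ k%:R^-1 <= (1 + k%:R^-1) ^+ J :> R.
Proof.
move=> k0; have k0' : 0 < k%:R :> R by rewrite ltr0n.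
have kV0 : 0 < k%:R^-1 :> R by rewrite invr_gt0.
have b0 : 0 <= 1 + k%:R^-1 :> R by rewrite addr_ge0 // ltW.
have two : 2 `^ k%:R^-1 <= 1 + k%:R^-1 :> R.
  have h : 2 <= (1 + k%:R^-1) ^+ k :> R.
    by have := bernoulli k (ltW kV0); rewrite divff ?gt_eqF.
  apply: (@le_trans _ _ (((1 + k%:R^-1) ^+ k) `^ k%:R^-1)).
    by apply: ge0_ler_powR => //; rewrite ?nnegrE ?exprn_ge0 // ltW.
  by rewrite -powR_mulrn // -powRrM divff ?gt_eqF // powRr1.
rewrite natrX -powR_mulrn // -powRrM mulrC powRrM powR_mulrn ?powR_ge0 //.
by apply: lerXn2r => //; rewrite nnegrE powR_ge0.
Qed.

(** Here [F] is [phi(K)] and [x] is [n = 2^j]; [x / 4 / 16] collects [n0 = n / 4], the 1/8 of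
    [sum_max_welfare] and the 1/2 of the bottom valuation. If [F] is nonzero,
    [rho c <= 64 (4 + 1/2) / 0.999 < 300]. *)
Lemma approximation_lt (R : realType) (c x rho F err : R) :
  0 < c -> 0 <= F -> 0 < x -> 2 * err <= F ->
  (1 - 1 / 1000) * rho * c * (F * (x / 4 / 16)) <= 2 * F * (x + x) + x * err ->
  F = 0 \/ rho * c <= 300.
Proof.
move=> c0 F0 x0 errF h; have [->|Fn] := eqVneq F 0; [by left|right].
have F1 : 0 < F by rewrite lt_neqAle eq_sym Fn.
have h1 : x * (2 * err) <= x * F by rewrite ler_pM2l.
have : (rho * c) * (x * F) <= 300 * (x * F) by nra.
by rewrite ler_pM2r // mulr_gt0.
Qed.

(** For [n = 2^J] this is [n^10 = K 2^J] with [K = n^9], the mean size of a core after [J] flips. *)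
Definition item_count (n : nat) : nat := (2 ^ (10 * trunc_log 2 n))%N.

Lemma item_count_poly : poly_bounded item_count.
Proof.
(* The summand 1 covers [n = 0], where there is one item. *)
exists ('X^10 + 1) => n; rewrite hornerD hornerXn hornerC natrXE /item_count.
case: n => [|n]; first by rewrite (_ : trunc_log 2 0 = 0)%N.
rewrite mulnC expnM; apply: leq_trans (leq_addr _ _).
by rewrite leq_exp2r // trunc_logP.
Qed.

(** * Numerical estimates *)

Section Numerics.
Variables (R : realType) (J q : nat).
Hypothesis J_large : 12000 <= 2 ^+ J :> R.
Hypothesis q_small : (16 * (2 ^ J) ^ 10 * q.+1 <= 2 ^ (2 ^ J))%N.

Let rate : R := (1 - 1 / 1000) ^+ 2 * (161 / 160).

(** The gain 161/160 of a level must outweigh two truthfulness losses; [eps = 1/1000] is small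
    enough for this. *)
Lemma rate_bounds : 1 + 1 / 250 <= rate <= 65 / 64.
Proof. by rewrite /rate; apply/andP; split; lra. Qed.

Lemma growth_sum_le : growth_sum (1 / 1000 : R) J <= 250 * rate ^+ J.
Proof.
have /andP[r1 _] := rate_bounds.
have E : rate ^+ J - 1 = (rate - 1) * growth_sum (1 / 1000 : R) J by rewrite subrX1.
have := ler_wpM2r (growth_sum_ge0 (1 / 1000 : R) J) (_ : 1 / 250 <= rate - 1).
by rewrite -E => /(_ _) h; have : 1 / 250 <= rate - 1 by [lra|move=> /h]; lra.
Qed.

Lemma hiding_error_le : hiding_error R q (10 * J + 2) (2 ^ J) <= 1.
Proof.
rewrite /hiding_error !mulrA ler_pdivrMr ?exprn_gt0 // mul1r.
apply: (@le_trans _ _ ((2 ^ (2 ^ J))%:R)).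
  apply: le_trans (_ : (16 * (2 ^ J) ^ 10 * q.+1)%:R <= _); last by rewrite ler_nat.
  rewrite -natrX -!natrM ler_nat expnD mulnC (mulnC 10) expnM.
  by rewrite mulnA (mulnC _ (2 ^ 2)%N) mulnA.
by rewrite natrX lerXn2r ?nnegrE // ler_nat.
Qed.

(** Here [w t = 64^J], so a level costs at most [17 * 64^J]. The powers fit below [phi(K)] by
    [64 rate <= 65] and [65 * 2 <= (7/4)^9], the constants by [2 * 17 * 250 <= 3/4 * 12000], which
    explains 12000. *)
Lemma total_error_le :
  2 * (level_error R q (10 * J + 2) (2 ^ (5 * J)) (2 ^ J) * growth_sum (1 / 1000) J) <=
  phi R (10 * J + 2) (2 ^ (9 * J)).
Proof.
have /andP[r1 r2] := rate_bounds.
have phiJ : 3 / 4 * (7 / 4) ^+ (9 * J) <= phi R (10 * J + 2) (2 ^ (9 * J)).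
  by apply: phi_pow_ge; clear; lia.
apply: le_trans phiJ.
have e1 : level_error R q (10 * J + 2) (2 ^ (5 * J)) (2 ^ J) <= 17 * 64 ^+ J.
  have one : 1 <= 64 ^+ J :> R by rewrite exprn_ege1 // ler1n.
  have bE : (2 ^ (5 * J) * 2 ^ J = 64 ^ J)%N.
    by rewrite -expnD addnC -mulSn (expnM 2 6).
  rewrite /level_error bE (natrM _ 16) (natrX _ 64).
  by have := hiding_error_le; lra.
have e2 := growth_sum_le.
apply: (@le_trans _ _ (2 * ((17 * 64 ^+ J) * (250 * rate ^+ J)))).
  rewrite ler_pM2l //; apply: ler_pM => //.
    exact: level_error_ge0.
  exact: growth_sum_ge0.
have p65 : 0 <= 65 ^+ J :> R by rewrite exprn_ge0.
have h1 : 64 ^+ J * rate ^+ J <= 65 ^+ J :> R.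
  by rewrite -exprMn; apply: lerXn2r; rewrite ?nnegrE //; lra.
have h2 : 65 ^+ J * 2 ^+ J <= (7 / 4) ^+ (9 * J) :> R.
  by rewrite -exprMn exprM; apply: lerXn2r; rewrite ?nnegrE; lra.
have h3 := ler_wpM2l p65 J_large; lra.
Qed.

End Numerics.

Lemma small_exponent (R : realType) : exists g : R,
  [/\ 0 < g, g <= 1 / 1000 & forall J, (2 ^ J)%:R `^ g <= (1 + g) ^+ J].
Proof.
exists 1000%:R^-1; split; first by rewrite invr_gt0 ltr0n.
  by rewrite mul1r.
by move=> J; apply: powR_2_pow_le.
Qed.

Local Open Scope classical_set_scope.

Theorem theorem5p1 (R : realType) :
  exists (eps gamma : R) (m : nat -> nat),
    [/\ 0 < eps, 0 < gamma, poly_bounded m &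
      ~ exists M : forall n : nat, mechanism R n (m n),
          [/\ (forall n, individually_rational (M n) /\ nonneg_payments (M n)),
              (forall n, approx_truthful (M n) eps),
              (exists2 q : nat -> nat, poly_bounded q &
                 forall n, queries_at_most (M n) (q n)) &
              (\forall n \near \oo, exists2 c : R,
                 n%:R `^ (- gamma) < c & achieves_approximation (M n) c)]].
Proof.
have [g [g0 g1 gJ]] := small_exponent R.
exists (1 / 1000), g, item_count; split; [lra | exact: g0 | exact: item_count_poly | ].
have eps0 : 0 <= 1 / 1000 :> R by lra.
have eps1 : 1 / 1000 < 1 :> R by lra.
have x1 : 1 < 1002 / 1001 :> R by lra.
case=> M [rat_pay truthful [q /poly_bounded_exp2[n1 hq] queries] [n2 _ approx]].
(* The value 301 is chosen to exceed the 300 of [approximation_lt]. *)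
have [J1 hJ1] := exp_unbounded 301 x1.
have [J2 hJ2] := exp_unbounded 12000 (ltr1n R 2 : 1 < 2 :> R).
have [J [Jn1 Jn2 JJ1 JJ2 J2']] : exists J, [/\ n1 <= J, n2 <= J, J1 <= J, J2 <= J & 2 <= J]%N.
  by exists (n1 + n2 + J1 + J2 + 2)%N; split; clear; lia.
pose n := (2 ^ J)%N.
have Jn : (J <= n)%N by rewrite ltnW // ltn_expl.
have logn : trunc_log 2 n = J by rewrite trunc_expnK.
have mE : item_count n = (2 ^ (10 * J))%N by rewrite /item_count logn.
have big2 : 12000 <= 2 ^+ J :> R by apply: hJ2.
have qs : (16 * (2 ^ J) ^ 10 * (q n).+1 <= 2 ^ (2 ^ J))%N.
  by apply: hq; apply: leq_trans Jn.
have [c cgt happ] : exists2 c : R, n%:R `^ (- g) < c & achieves_approximation (M n) c.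
  by apply: approx; apply: leq_trans Jn.
have c0 : 0 < c by apply: le_lt_trans cgt; apply: powR_ge0.
have [rat pay] := rat_pay n.
have kJ : 0 <= (161 / 160) ^+ J / 2 :> R by rewrite divr_ge0 // exprn_ge0 // divr_ge0.
have four : (2 ^ J = 4 * 2 ^ (J - 2))%N by rewrite -(expnD 2 2) subnKC.
(* Parameters: [w^2 = m]; [t = n] makes detection exponentially unlikely; [2^(L-1) = 2 m]; the mean
   core size is [K = n^9]; and [n0 = n / 4]. *)
have bound : (1 - 1 / 1000) * ((1 - 1 / 1000) ^+ 2) ^+ J * c *
    ((161 / 160) ^+ J / 2 * phi R (10 * J + 2) (2 ^ (9 * J)) * ((2 ^ (J - 2))%:R / 8)) <=
    2 * phi R (10 * J + 2) (2 ^ (9 * J)) * (n%:R + 2 ^+ J) +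
    n%:R * (level_error R (q n) (10 * J + 2) (2 ^ (5 * J)) (2 ^ J) * growth_sum (1 / 1000) J).
  apply: (approximation_bound (M := M n) eps0 eps1 rat pay (truthful n) (queries n)
    (w := (2 ^ (5 * J))%N) (t := (2 ^ J)%N) (L := (10 * J + 2)%N) (j := J)
    (K := (2 ^ (9 * J))%N) (n0 := (2 ^ (J - 2))%N)
    _ _ _ _ _ _ _ _ _ ler01 kJ erefl (ltW c0) happ); rewrite ?expn_gt0 // ?mE.
  - by rewrite -expnD leq_exp2l //; clear; lia.
  - by rewrite addn2.
  - by rewrite addn2 ltn_exp2l.
  - by rewrite -expnD; congr (2 ^ _)%N; clear; lia.
  - by rewrite /n leq_exp2l // leq_subr.
  - by rewrite -four.
have err := total_error_le big2 qs.
set F := phi R _ _ in bound err; set E := _ * growth_sum _ _ in bound err.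
have F0 : 0 < F.
  apply: lt_le_trans (@phi_pow_ge R (10 * J + 2) (9 * J) _); last by clear; lia.
  by rewrite mulr_gt0 ?divr_gt0 // exprn_gt0 // divr_gt0.
pose x : R := 2 ^+ J; have x0 : 0 < x by rewrite exprn_gt0.
have [r rE] : exists r : R, r = (1 - 1 / 1000) ^+ 2 * (161 / 160) by eexists.
have r1 : 1 + 1 / 250 <= r by have /andP[] := rate_bounds R; rewrite rE.
pose rho := r ^+ J.
have nE : n%:R = x :> R by rewrite natrX.
have n0E : (2 ^ (J - 2))%:R = x / 4 :> R.
  by rewrite -nE /n four natrM mulrAC divff ?mul1r // pnatr_eq0.
case: (@approximation_lt R c x rho F E c0 (ltW F0) x0 err) => [|F0'|].
- have arith (e u v d f y : R) :
      e * u * d * (v / 2 * f * (y / 4 / 8)) = e * (u * v) * d * (f * (y / 4 / 16)) by field.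
  by move: bound; rewrite n0E nE arith /rho rE (exprMn J ((1 - 1 / 1000) ^+ 2) (161 / 160)).
- by move: F0; rewrite F0' ltxx.
apply/negP; rewrite -ltNge.
have Vpos : 0 < (1 + g) ^+ J :> R by rewrite exprn_gt0 // addr_gt0.
have cV : ((1 + g) ^+ J)^-1 < c.
  apply: le_lt_trans cgt; rewrite powRN lef_pV2 ?posrE ?powR_gt0 ?ltr0n ?expn_gt0 //.
  exact: gJ.
have r0 : 0 < r by clear - r1; lra.
have rho0 : 0 < rho by apply: exprn_gt0.
(* From [c > (1 + g)^-J] and [(1002/1001) (1 + g) <= 1002/1000 <= r], the product [rho c] exceeds
   [(1002/1001)^J >= 301]. *)
apply: (@lt_le_trans _ _ 301); first by rewrite ltr_nat.
apply: le_trans (hJ1 J _) _; first exact: JJ1.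
apply: le_trans (ltW (_ : rho * ((1 + g) ^+ J)^-1 < _)); last by rewrite ltr_pM2l.
rewrite ler_pdivlMr // -exprMn; clear - g0 g1 r0 r1.
by apply: lerXn2r; rewrite ?nnegrE; [apply: mulr_ge0; lra | exact: ltW | lra].
Qed.
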